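(* Let $J,K\ge 1$ be integers, let $P=(p_{j,k})_{0\le j\le J,\,0\le k\le K}$ and $Q=(q_{k,j})_{1\le k\le K,\,1\le j\le J}$ be probability distributions satisfying the consistency conditions (C1) and (C2) of the context, and let $\delta\in(1/2,1)$ be fixed. For each admissible $N$, consider the random directed graph on the nodes $\{1,\dots,N\}$ generated by the algorithm described in the context. Fix $s\in\mathbb{N}$. (i) Let $(j_{v_1},k_{v_1}),\ldots,(j_{v_s},k_{v_s})$ be the types of $s$ randomly chosen nodes $v_1,\dots,v_s$ of this graph. Then, as $N\to\infty$, $$\big((j_{v_1},k_{v_1}),\ldots,(j_{v_s},k_{v_s})\big)\ \stackrel{d}{\longrightarrow}\ \big((j'_1,k'_1),\ldots,(j'_s,k'_s)\big),$$ where $(j'_1,k'_1),\ldots,(j'_s,k'_s)$ are $s$ independent random variables each having distribution $P$. (ii) The types of $s$ randomly chosen edges of this graph converge in distribution, as $N\to\infty$, to a sequence of $s$ independent random variables each having distribution $Q$.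
   Context: Notation. For integers $0\le l\le n$ write $[n]_l=\{l,\ldots,n\}$; $\lceil x\rceil$ is the smallest integer $\ge x$. Graphs are directed and may contain self-loops and multiple edges. A node $v$ is of type $(j,k)$ if its in-degree is $j$ and its out-degree is $k$. A directed edge $e=\langle v,w\rangle$ (from $v$ to $w$) is of type $(k,j)$ if the out-degree of $v$ is $k$ and the in-degree of $w$ is $j$. Distributions. $P=(p_{j,k})_{j\in[J]_0,k\in[K]_0}$ and $Q=(q_{k,j})_{k\in[K]_1,j\in[J]_1}$ are probability distributions with marginals $p_j^-=\sum_{k'\in[K]_0}p_{j,k'}$, $p_k^+=\sum_{j'\in[J]_0}p_{j',k}$, $q_k^+=\sum_{j'\in[J]_1}q_{k,j'}$, $q_j^-=\sum_{k'\in[K]_1}q_{k',j}$. With $z=\sum_{k\in[K]_0}kp_k^+$, assumed $>0$, the consistency conditions are: (C1) $q_k^+=kp_k^+/z$ for all $k\in[K]_1$; (C2) $q_j^-=jp_j^-/z$ for all $j\in[J]_1$. Algorithm. Fix $\delta\in(1/2,1)$. $N\in\mathbb{N}$ is admissible if there is $N'\in\mathbb{N}$, $N'\geq 1$, with $N=N'+2\lceil N^\delta\rceil+\max\{J^2,K^2\}$ (true for all large $N$); set $N''=N'+\lceil N^\delta\rceil$. Step 1. Assign to each node $v=1,\ldots,N'$ independently a type $(j_v,k_v)$ with distribution $P$. Generate edges $e=1,\ldots,\lceil zN''\rceil$ with independent types $(k_e,j_e)$ with distribution $Q$, independently of the node-types. For $k\in[K]_1$ and $j\in[J]_1$ put $n_k^+=\sum_{v=1}^{N'}1_{\{k_v=k\}}$,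 $e_k^+=\big\lceil\frac1k\sum_{e=1}^{\lceil zN''\rceil}1_{\{k_e=k\}}\big\rceil$, $n_j^-=\sum_{v=1}^{N'}1_{\{j_v=j\}}$, $e_j^-=\big\lceil\frac1j\sum_{e=1}^{\lceil zN''\rceil}1_{\{j_e=j\}}\big\rceil$. Let $A_N$ be the event that $|n_k^+-p_k^+N'|\le p_k^+N^\delta/2$ and $|e_k^+-p_k^+N''|\le p_k^+N^\delta/2$ for all $k\in[K]_1$, and $|n_j^--p_j^-N'|\le p_j^-N^\delta/2$ and $|e_j^--p_j^-N''|\le p_j^-N^\delta/2$ for all $j\in[J]_1$. If $A_N$ occurs go to Step 2, otherwise go to Step 5. Step 2. For each $k\in[K]_1$ add $r_k^+=ke_k^+-\sum_{e=1}^{\lceil zN''\rceil}1_{\{k_e=k\}}$ edges of type $(k,1)$; for each $j\in[J]_1$ add $r_j^-=je_j^--\sum_{e=1}^{\lceil zN''\rceil}1_{\{j_e=j\}}$ edges of type $(1,j)$. Set $r^+=\sum_{k\in[K]_1}r_k^+$, $r^-=\sum_{j\in[J]_1}r_j^-$. Step 3. Set the type of each node in $\{N'+1,\ldots,N\}$ to $(0,0)$. Successively for each $k\in[K]_1$, take the first $e_k^+-n_k^++r^-1_{\{k=1\}}$ nodes in $\{N'+1,\ldots,N\}$ having out-degree $0$ and change their out-degrees to $k$. Successively for each $j\in[J]_1$, take the first $e_j^--n_j^-+r^+1_{\{j=1\}}$ nodes in $\{N'+1,\ldots,N\}$ having in-degree $0$ and change their in-degrees to $j$. (On $A_N$ these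 numbers are nonnegative and enough nodes are available.) Step 4. For each $k\in[K]_1$, assign to each node of out-degree $k$ exactly $k$ uniformly chosen edges $e$ with $k_e=k$ (as edges leaving that node); for each $j\in[J]_1$, assign to each node of in-degree $j$ exactly $j$ uniformly chosen edges $e$ with $j_e=j$ (as edges arriving at that node). Each edge is used exactly once at each end (the numbers match exactly), so these assignments are uniformly random allocations, made independently for the different $k$ and $j$ given the types. Go to Step 6. Step 5. Set node-types $(j_1,k_1)=(0,1)$, $(j_2,k_2)=(1,0)$, $(j_v,k_v)=(0,0)$ for $v=3,\ldots,N$, and insert the single edge $\langle1,2\rangle$. Step 6. Return the constructed graph. Convention. ''$s$ randomly chosen nodes (edges)'' means $s$ nodes (edges) each chosen uniformly from all nodes (edges) of the graph, independently of each other given the graph, and with the choice of nodes independent of the graph. Limits $N\to\infty$ are along admissible $N$. *)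

(* Defs.v *)
From HB Require Import structures.
From mathcomp Require Import all_boot all_order all_algebra.
From mathcomp Require Import all_classical all_reals all_analysis.
Set Implicit Arguments.
Unset Strict Implicit.
Unset Printing Implicit Defensive.
Import Order.TTheory GRing.Theory Num.Theory.
Import numFieldNormedType.Exports.
Local Open Scope classical_set_scope.
Local Open Scope ring_scope.

(* Finitely supported probability distributions on an arbitrary type, as convex
   combinations of Dirac masses: the entry (c, x) carries mass c at the point x.
   A point may occur in several entries. *)
Record distr (R : realType) (T : Type) := Distr {
  weights :> seq (R * T);
  weights_ge0 : all (fun w => 0 <= w.1) weights;
  weights_sum1 : \sum_(w <- weights) w.1 = 1 }.

Definition expect (R : realType) (T : Type) (mu : distr R T) (f : T -> R) : R :=
  \sum_(w <- mu) w.1 * f w.2.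

Section DistrOperations.
Variable R : realType.

Lemma dret_ge0 T (x : T) : all (fun w : R * T => 0 <= w.1) [:: (1, x)].
Proof. by rewrite /= ler01. Qed.

Lemma dret_sum1 T (x : T) : \sum_(w <- [:: (1 : R, x)]) w.1 = 1.
Proof. by rewrite big_seq1. Qed.

Definition dret T (x : T) : distr R T := Distr (dret_ge0 x) (dret_sum1 x).

Definition dbind_weights T U (mu : distr R T) (nu : T -> distr R U) :=
  [seq (w.1 * u.1, u.2) | w <- weights mu, u <- weights (nu w.2)].

Lemma dbind_ge0 T U (mu : distr R T) (nu : T -> distr R U) :
  all (fun w => 0 <= w.1) (dbind_weights mu nu).
Proof.
rewrite /dbind_weights; elim: (weights mu) (weights_ge0 mu) => //= w s IHs.
case/andP=> w_ge0 /IHs {}IHs; rewrite all_cat IHs andbT all_map.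
by apply: sub_all (weights_ge0 (nu w.2)) => u u_ge0 /=; rewrite mulr_ge0.
Qed.

Lemma dbind_sum1 T U (mu : distr R T) (nu : T -> distr R U) :
  \sum_(w <- dbind_weights mu nu) w.1 = 1.
Proof.
rewrite big_allpairs_dep /= -(weights_sum1 mu); apply: eq_bigr => w _.
by rewrite -mulr_sumr weights_sum1 mulr1.
Qed.

Definition dbind T U (mu : distr R T) (nu : T -> distr R U) : distr R U :=
  Distr (dbind_ge0 mu nu) (dbind_sum1 mu nu).

Definition is_pmf T (s : seq T) (p : T -> R) : Prop :=
  all (fun x => 0 <= p x) s /\ \sum_(x <- s) p x = 1.

Lemma dpmf_ge0 T (s : seq T) (p : T -> R) : is_pmf s p ->
  all (fun w => 0 <= w.1) [seq (p x, x) | x <- s].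
Proof. by case=> p_ge0 _; rewrite all_map. Qed.

Lemma dpmf_sum1 T (s : seq T) (p : T -> R) : is_pmf s p ->
  \sum_(w <- [seq (p x, x) | x <- s]) w.1 = 1.
Proof. by case=> _ p_sum; rewrite big_map. Qed.

Definition dpmf T (s : seq T) (p : T -> R) (hp : is_pmf s p) : distr R T :=
  Distr (dpmf_ge0 hp) (dpmf_sum1 hp).

Lemma unif_pmf T (x : T) (s : seq T) :
  is_pmf (x :: s) (fun=> (size (x :: s))%:R^-1).
Proof.
split.
  have : 0 <= (size (x :: s))%:R^-1 :> R by rewrite invr_ge0 ler0n.
  by move: _%:R^-1 => c c_ge0; elim: (x :: s) => //= y s' ->; rewrite c_ge0.
by rewrite big_const_seq count_predT iter_addr_0 -[LHS]mulr_natl mulfV ?pnatr_eq0.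
Qed.

(* The value [x0] is only used to make the uniform distribution on the empty
   sequence total. *)
Definition dunif T (x0 : T) (s : seq T) : distr R T :=
  if s is x :: s' then dpmf (unif_pmf x s') else dret x0.

End DistrOperations.

Notation "'let!' x ':=' mu 'in' nu" := (dbind mu (fun x => nu))
  (at level 200, x name, mu at level 100, nu at level 200,
   format "'[hv' 'let!'  x  ':='  mu  'in'  '/' nu ']'").

Section Products.
Variable R : realType.

Fixpoint diid T (mu : distr R T) (n : nat) : distr R (n.-tuple T) :=
  if n is m.+1 then
    let! x := mu in let! t := diid mu m in dret R [tuple of x :: t]
  else dret R [tuple].

Fixpoint dprod T (mus : seq (distr R T)) : distr R (seq T) :=
  if mus is mu :: mus' then
    let! x := mu in let! xs := dprod mus' in dret R (x :: xs)
  else dret R [::].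

End Products.

(* Convergence in distribution, along the indices in [D], of probability
   measures on a discrete space [T], on which every function is continuous. *)
Definition cvg_in_distr (R : realType) (T : Type) (D : set nat)
    (mu : nat -> distr R T) (nu : distr R T) : Prop :=
  forall f : T -> R, (exists C, forall x, `|f x| <= C) ->
    expect (mu N) f @[N --> within D \oo] --> expect nu f.

(* Directed multigraphs with loops, on the nodes 1, ..., [nb_nodes g]; the pair
   (v, w) stands for an edge from v to w and is listed with multiplicity. *)
Record digraph := Digraph { nb_nodes : nat; edges : seq (nat * nat) }.

Definition indeg (g : digraph) (v : nat) : nat :=
  count (fun e => e.2 == v) (edges g).
Definition outdeg (g : digraph) (v : nat) : nat :=
  count (fun e => e.1 == v) (edges g).
Definition node_type (g : digraph) (v : nat) : nat * nat :=
  (indeg g v, outdeg g v).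
Definition edge_type (g : digraph) (e : nat * nat) : nat * nat :=
  (outdeg g e.1, indeg g e.2).

Definition node_types (J K : nat) : seq (nat * nat) :=
  [seq (j, k) | j <- iota 0 J.+1, k <- iota 0 K.+1].
Definition edge_types (J K : nat) : seq (nat * nat) :=
  [seq (k, j) | k <- iota 1 K, j <- iota 1 J].

Section Marginals.
Variables (R : realType) (J K : nat) (P Q : nat * nat -> R).

Definition p_in (j : nat) : R := \sum_(0 <= k < K.+1) P (j, k).
Definition p_out (k : nat) : R := \sum_(0 <= j < J.+1) P (j, k).
Definition q_out (k : nat) : R := \sum_(1 <= j < J.+1) Q (k, j).
Definition q_in (j : nat) : R := \sum_(1 <= k < K.+1) Q (k, j).
Definition mean_degree : R := \sum_(0 <= k < K.+1) k%:R * p_out k.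

Definition consistency1 : Prop := forall k, (1 <= k <= K)%N ->
  q_out k = k%:R * p_out k / mean_degree.
Definition consistency2 : Prop := forall j, (1 <= j <= J)%N ->
  q_in j = j%:R * p_in j / mean_degree.

End Marginals.

(* Only applied to nonnegative reals, on which it is the ceiling. *)
Definition natceil (R : realType) (x : R) : nat := `|Num.ceil x|%N.

(* Applies [f] to the first [m] entries satisfying [a]. *)
Fixpoint change_first T (a : pred T) (f : T -> T) (m : nat) (s : seq T) :=
  if s is x :: s' then
    if m is m'.+1 then
      if a x then f x :: change_first a f m' s' else x :: change_first a f m s'
    else s
  else [::].

Section Algorithm.
Variables (R : realType) (J K : nat) (P Q : nat * nat -> R).
Hypotheses (hP : is_pmf (node_types J K) P) (hQ : is_pmf (edge_types J K) Q).
Variable delta : R.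

Let z : R := mean_degree J K P.

Definition slack (N : nat) : nat := natceil (N%:R `^ delta).

Definition admissible : set nat := [set N | exists N' : nat,
  (1 <= N')%N /\ N = (N' + 2 * slack N + maxn (J ^ 2) (K ^ 2))%N].

(* For admissible [N] this is the unique N' in the definition above. *)
Definition N1 (N : nat) : nat := (N - (2 * slack N + maxn (J ^ 2) (K ^ 2)))%N.
Definition N2 (N : nat) : nat := (N1 N + slack N)%N.
Definition nb_edges (N : nat) : nat := natceil (z * (N2 N)%:R).

(* In what follows, [nt] lists node-types (j_v, k_v), the node v being at
   position v - 1, and [et] lists edge-types (k_e, j_e), an edge being
   identified with its position. *)

Definition n_out (nt : seq (nat * nat)) (k : nat) := count (fun t => t.2 == k) nt.
Definition n_in (nt : seq (nat * nat)) (j : nat) := count (fun t => t.1 == j) nt.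
Definition m_out (et : seq (nat * nat)) (k : nat) := count (fun t => t.1 == k) et.
Definition m_in (et : seq (nat * nat)) (j : nat) := count (fun t => t.2 == j) et.
Definition e_out (et : seq (nat * nat)) (k : nat) : nat :=
  natceil (k%:R^-1 * (m_out et k)%:R : R).
Definition e_in (et : seq (nat * nat)) (j : nat) : nat :=
  natceil (j%:R^-1 * (m_in et j)%:R : R).

Definition good (N : nat) (nt et : seq (nat * nat)) : bool :=
  all (fun k =>
      (`|(n_out nt k)%:R - p_out J P k * (N1 N)%:R|
         <= p_out J P k * N%:R `^ delta / 2) &&
      (`|(e_out et k)%:R - p_out J P k * (N2 N)%:R|
         <= p_out J P k * N%:R `^ delta / 2))
    (iota 1 K) &&
  all (fun j =>
      (`|(n_in nt j)%:R - p_in K P j * (N1 N)%:R|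
         <= p_in K P j * N%:R `^ delta / 2) &&
      (`|(e_in et j)%:R - p_in K P j * (N2 N)%:R|
         <= p_in K P j * N%:R `^ delta / 2))
    (iota 1 J).

Definition r_out (et : seq (nat * nat)) (k : nat) : nat :=
  (k * e_out et k - m_out et k)%N.
Definition r_in (et : seq (nat * nat)) (j : nat) : nat :=
  (j * e_in et j - m_in et j)%N.

Definition all_edge_types (et : seq (nat * nat)) : seq (nat * nat) :=
  et ++ flatten [seq nseq (r_out et k) (k, 1%N) | k <- iota 1 K]
     ++ flatten [seq nseq (r_in et j) (1%N, j) | j <- iota 1 J].

Definition set_outdegs (nt et ts : seq (nat * nat)) : seq (nat * nat) :=
  foldl (fun ts k =>
      change_first (fun t => t.2 == 0%N) (fun t => (t.1, k))
        (e_out et k - n_out nt k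
         + (if k == 1 then \sum_(1 <= j < J.+1) r_in et j else 0))%N ts)
    ts (iota 1 K).

Definition set_indegs (nt et ts : seq (nat * nat)) : seq (nat * nat) :=
  foldl (fun ts j =>
      change_first (fun t => t.1 == 0%N) (fun t => (j, t.2))
        (e_in et j - n_in nt j
         + (if j == 1 then \sum_(1 <= k < K.+1) r_out et k else 0))%N ts)
    ts (iota 1 J).

Definition all_node_types (N : nat) (nt et : seq (nat * nat)) :=
  nt ++ set_indegs nt et (set_outdegs nt et (nseq (N - N1 N) (0%N, 0%N))).

Definition nodes_out (nt : seq (nat * nat)) (k : nat) : seq nat :=
  [seq v <- iota 1 (size nt) | (nth (0%N, 0%N) nt v.-1).2 == k].
Definition nodes_in (nt : seq (nat * nat)) (j : nat) : seq nat :=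
  [seq v <- iota 1 (size nt) | (nth (0%N, 0%N) nt v.-1).1 == j].
Definition edges_out (et : seq (nat * nat)) (k : nat) : seq nat :=
  [seq e <- iota 0 (size et) | (nth (0%N, 0%N) et e).1 == k].
Definition edges_in (et : seq (nat * nat)) (j : nat) : seq nat :=
  [seq e <- iota 0 (size et) | (nth (0%N, 0%N) et e).2 == j].

(* The node receiving the edge [e] when the edges are dealt out in the order
   [es], the first [d] of them to the first node of [vs], the next [d] to the
   second one, and so on. *)
Definition dealt_to (d : nat) (vs es : seq nat) (e : nat) : nat :=
  nth 0%N (flatten [seq nseq d v | v <- vs]) (index e es).

(* For each k, the edges with k_e = k are dealt out, k to each node of
   out-degree k, in a uniformly random order (the k-th order is at position
   k - 1 of [sigma]), and likewise for the in-degrees, all the orders being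
   independent. *)
Definition allocate (nt et : seq (nat * nat)) : distr R digraph :=
  let! sigma := dprod
    [seq dunif R [::] (permutations (edges_out et k)) | k <- iota 1 K] in
  let! tau := dprod
    [seq dunif R [::] (permutations (edges_in et j)) | j <- iota 1 J] in
  let tail e := let k := (nth (0%N, 0%N) et e).1 in
    dealt_to k (nodes_out nt k) (nth [::] sigma k.-1) e in
  let head e := let j := (nth (0%N, 0%N) et e).2 in
    dealt_to j (nodes_in nt j) (nth [::] tau j.-1) e in
  dret R (Digraph (size nt) [seq (tail e, head e) | e <- iota 0 (size et)]).

Definition random_digraph (N : nat) : distr R digraph :=
  let! nt := diid (dpmf hP) (N1 N) in
  let! et := diid (dpmf hQ) (nb_edges N) in
  if good N nt et then allocate (all_node_types N nt et) (all_edge_types et)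
  else dret R (Digraph N [:: (1%N, 2%N)]).

Definition random_node_types (s N : nat) : distr R (s.-tuple (nat * nat)) :=
  let! g := random_digraph N in
  let! vs := diid (dunif R 0%N (iota 1 (nb_nodes g))) s in
  dret R [tuple of [seq node_type g v | v <- vs]].

Definition random_edge_types (s N : nat) : distr R (s.-tuple (nat * nat)) :=
  let! g := random_digraph N in
  let! es := diid (dunif R (0%N, 0%N) (edges g)) s in
  dret R [tuple of [seq edge_type g e | e <- es]].

End Algorithm.

(* Main.v *)
(* When [good] holds, the construction is exact: the number of half-edges of each
   degree matches the number of slots of that degree, so for every outcome of the
   random allocation the list of node types of the graph is the list of sampled
   node types followed by those of the N - N' added nodes, and the list of edge
   types is the list of sampled edge types followed by at most K^2 + J^2 added ones.
   As N - N' = O(N^delta) = o(N), sampling nodes or edges uniformly differs from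
   sampling from P or Q by at most the empirical frequency fluctuations, which are
   O(N^(-1/2)) in mean, plus the vanishing share of added entries.  By Chebyshev's
   inequality the complement of [good] has probability O(N^(1 - 2 delta)), which
   tends to 0 because delta > 1/2. *)

Require Import Defs.
From HB Require Import structures.
From mathcomp Require Import all_boot all_order all_algebra.
From mathcomp Require Import all_classical all_reals all_analysis.
From mathcomp Require Import ring lra zify.
Set Implicit Arguments.
Unset Strict Implicit.
Unset Printing Implicit Defensive.
Import Order.TTheory GRing.Theory Num.Theory.
Import numFieldNormedType.Exports.
Local Open Scope classical_set_scope.
Local Open Scope ring_scope.

(** * Expectations and empirical counts *)

(** By (C1) and (C2) about [k p_k N''] of the [z N''] sampled edges carry the out-label [k], so
    [e_out] concentrates near [p_k N''] while [n_out] concentrates near [p_k N']. The gap [N'' - N']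
    is at least [N^delta], and [p_k N^delta] is exactly the sum of the two tolerances in [good].
    Hence the sampled nodes never oversupply a degree, and every mismatch can be repaired by adding
    nodes. The [2 * slack] part of the reserve pays for these nodes; [max{J^2, K^2}] pays for the
    nodes of degree 1 that absorb the edges added by rounding. The tolerances in [good] are
    proportional to [p_k], hence zero at degrees of probability zero. There a variance bound divided
    by the tolerance says nothing, and the count has to vanish almost surely instead. The [s] draws
    are compared with the limit law by replacing one coordinate at a time, so a single draw carries
    all the analysis. *)

Section Expectation.
Variable R : realType.

Lemma eq_expect T (mu : distr R T) f g : f =1 g -> expect mu f = expect mu g.
Proof. by move=> fg; apply: eq_bigr => w _; rewrite fg. Qed.

Lemma expect_dret T (x : T) (f : T -> R) : expect (dret R x) f = f x.
Proof. by rewrite /expect big_seq1 mul1r. Qed.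

Lemma expect_dbind T U (mu : distr R T) (nu : T -> distr R U) f :
  expect (dbind mu nu) f = expect mu (fun x => expect (nu x) f).
Proof.
rewrite /expect big_allpairs_dep /=; apply: eq_bigr => w _.
by rewrite mulr_sumr; apply: eq_bigr => u _; rewrite mulrA.
Qed.

Lemma expect_cst T (mu : distr R T) c : expect mu (fun=> c) = c.
Proof. by rewrite /expect -mulr_suml weights_sum1 mul1r. Qed.

Lemma expectD T (mu : distr R T) f g :
  expect mu (fun x => f x + g x) = expect mu f + expect mu g.
Proof. by rewrite /expect -big_split; apply: eq_bigr => w _; rewrite /= mulrDr. Qed.

Lemma expectZ T (mu : distr R T) c f :
  expect mu (fun x => c * f x) = c * expect mu f.
Proof. by rewrite /expect mulr_sumr; apply: eq_bigr => w _; rewrite mulrCA. Qed.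

Lemma expectB T (mu : distr R T) f g :
  expect mu (fun x => f x - g x) = expect mu f - expect mu g.
Proof.
by rewrite expectD -mulN1r -expectZ; congr (_ + _); apply: eq_expect => x; rewrite mulN1r.
Qed.

Lemma expect_sum T (mu : distr R T) (I : Type) (r : seq I) (F : I -> T -> R) :
  expect mu (fun x => \sum_(i <- r) F i x) = \sum_(i <- r) expect mu (F i).
Proof.
rewrite /expect exchange_big /=; apply: eq_bigr => w _.
by rewrite mulr_sumr.
Qed.

Lemma le_expect T (mu : distr R T) f g :
  (forall x, f x <= g x) -> expect mu f <= expect mu g.
Proof.
rewrite /expect => fg; elim: (weights mu) (weights_ge0 mu) => [|w s IHs] /=.
  by rewrite !big_nil.
by case/andP => w0 /IHs {}IHs; rewrite !big_cons lerD// ler_wpM2l.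
Qed.

Lemma ler_norm_expect T (mu : distr R T) f :
  `|expect mu f| <= expect mu (fun x => `|f x|).
Proof.
rewrite ler_norml; apply/andP; split.
  rewrite -mulN1r -expectZ; apply: le_expect => x.
  by rewrite mulN1r lerNl ler_normr lexx orbT.
by apply: le_expect => x; apply: ler_norm.
Qed.

Lemma expect_norm_le T (mu : distr R T) f C :
  (forall x, `|f x| <= C) -> `|expect mu f| <= C.
Proof.
move=> fC; apply: le_trans (ler_norm_expect _ _) _.
by rewrite -[leRHS](expect_cst mu); apply: le_expect.
Qed.

Lemma expect_diid_cons T (mu : distr R T) n (f : n.+1.-tuple T -> R) :
  expect (diid mu n.+1) f =
  expect mu (fun x => expect (diid mu n) (fun t => f [tuple of x :: t])).
Proof.
rewrite expect_dbind; apply: eq_expect => x.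
by rewrite expect_dbind; apply: eq_expect => t; rewrite expect_dret.
Qed.

(* [A] holds almost surely; testing against functions avoids asking for decidable
   equality on [T], which [digraph] lacks. *)
Definition surely T (mu : distr R T) (A : T -> Prop) : Prop :=
  forall f g : T -> R, (forall x, A x -> f x = g x) -> expect mu f = expect mu g.

Lemma surely_le T (mu : distr R T) (A : T -> Prop) f g : surely mu A ->
  (forall x, A x -> f x <= g x) -> expect mu f <= expect mu g.
Proof.
move=> hA fg; rewrite -subr_ge0 -expectB.
(* [surely] transports equalities only, so the inequality on [A] is encoded as the equality of
   [g - f] with its absolute value. *)
rewrite (hA _ (fun x => `|g x - f x|)) => [|x Ax].
  by rewrite -(expect_cst mu 0); apply: le_expect.
by rewrite ger0_norm// subr_ge0 fg.
Qed.

Lemma surely_sub T (mu : distr R T) (A B : T -> Prop) :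
  (forall x, A x -> B x) -> surely mu A -> surely mu B.
Proof. by move=> AB hA f g fg; apply: hA => x /AB; apply: fg. Qed.

Lemma surely_dret T (A : T -> Prop) x : A x -> surely (dret R x) A.
Proof. by move=> Ax f g fg; rewrite !expect_dret fg. Qed.

Lemma surely_dbind T U (mu : distr R T) (nu : T -> distr R U) A B :
  surely mu A -> (forall x, A x -> surely (nu x) B) -> surely (dbind mu nu) B.
Proof.
move=> hA hB f g fg; rewrite !expect_dbind.
by apply: hA => x Ax; apply: hB.
Qed.

Lemma expect_dpmf T (s : seq T) (p : T -> R) (hp : is_pmf s p) f :
  expect (dpmf hp) f = \sum_(x <- s) p x * f x.
Proof. by rewrite /expect big_map. Qed.

Lemma surely_dpmf (T : eqType) (s : seq T) p (hp : is_pmf s p) :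
  surely (dpmf hp) (fun x => x \in s).
Proof.
move=> f g fg; rewrite !expect_dpmf; apply: eq_big_seq => x xs.
by rewrite fg.
Qed.

Lemma expect_dunif T (x0 : T) s f : (0 < size s)%N ->
  expect (dunif R x0 s) f = (\sum_(x <- s) f x) / (size s)%:R.
Proof.
case: s => // x s _; rewrite expect_dpmf.
by rewrite mulr_suml; apply: eq_bigr => y _; rewrite mulrC.
Qed.

Lemma surely_dunif (T : eqType) (x0 : T) (s : seq T) : (0 < size s)%N ->
  surely (dunif R x0 s) (fun x => x \in s).
Proof. by case: s => // x s _; apply: surely_dpmf. Qed.

Lemma surely_diid T (mu : distr R T) n (A : pred T) :
  surely mu A -> surely (diid mu n) (fun t => all A t).
Proof.
move=> hA; elim: n => [|n IHn] /=; first exact: surely_dret.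
apply: surely_dbind (hA) _ => x Ax; apply: surely_dbind IHn _ => t At.
by apply: surely_dret; rewrite /= Ax.
Qed.

Lemma surely_dprod_iota T (x0 : T) (F : nat -> distr R T) (A : nat -> T -> Prop) m n :
  (forall k, (m <= k < m + n)%N -> surely (F k) (A k)) ->
  surely (dprod [seq F k | k <- iota m n])
    (fun xs => forall k, (m <= k < m + n)%N -> A k (nth x0 xs (k - m))).
Proof.
elim: n m => [|n IHn] m hF /=.
  by apply: surely_dret => k; rewrite addn0 => /andP[mk km]; have := leq_trans km mk; rewrite ltnn.
have hm : (m <= m < m + n.+1)%N by rewrite leqnn /= addnS ltnS leq_addr.
apply: surely_dbind (hF m hm) _ => x Ax.
apply: (surely_dbind (IHn m.+1 _)) => [k|xs Axs].
  by rewrite addSnnS => /andP[/ltnW mk kn]; apply: hF; rewrite mk.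
apply: surely_dret => k /andP[]; rewrite leq_eqVlt => /orP[/eqP <- _|mk kn].
  by rewrite subnn.
by rewrite -(subnSK mk); apply: Axs; rewrite mk addSnnS.
Qed.

Lemma expect_diid_sum T (mu : distr R T) (g : T -> R) n : expect mu g = 0 ->
  expect (diid mu n) (fun t => \sum_(x <- t) g x) = 0.
Proof.
move=> g0; elim: n => [|n IHn]; first by rewrite expect_dret big_nil.
rewrite expect_diid_cons -[RHS]g0; apply: eq_expect => x.
under eq_expect => t do rewrite big_cons.
by rewrite expectD expect_cst IHn addr0.
Qed.

(** The cross terms vanish because the summands are independent and centered, so variances add
    up. *)
Lemma expect_diid_sum_sqr T (mu : distr R T) (g : T -> R) n : expect mu g = 0 ->
  expect (diid mu n) (fun t => (\sum_(x <- t) g x) ^+ 2) =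
  n%:R * expect mu (fun x => g x ^+ 2).
Proof.
move=> g0; elim: n => [|n IHn]; first by rewrite expect_dret big_nil expr0n mul0r.
rewrite expect_diid_cons -natr1 mulrDl mul1r -{}IHn.
rewrite addrC -[X in _ + X](expect_cst mu) -expectD; apply: eq_expect => x.
rewrite (eq_expect _ (g := fun t : n.-tuple T => g x ^+ 2 +
  (g x *+ 2) * (\sum_(y <- t) g y) + (\sum_(y <- t) g y) ^+ 2)) => [|t].
  by rewrite !expectD expectZ expect_diid_sum// mulr0 addr0 expect_cst.
by rewrite big_cons sqrrD mulrnAl.
Qed.

Section Counting.
Variables (T : Type) (mu : distr R T) (a : pred T).
Let p := expect mu (fun x => (a x)%:R).

Lemma sum_centered_count (t : seq T) :
  \sum_(x <- t) ((a x)%:R - p) = (count a t)%:R - (size t)%:R * p.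
Proof.
elim: t => [|x t IHt] /=; first by rewrite big_nil mul0r subr0.
by rewrite big_cons IHt natrD -natr1; lra.
Qed.

Lemma expect_count n : expect (diid mu n) (fun t => (count a t)%:R) = n%:R * p.
Proof.
apply/eqP; rewrite -subr_eq0 -[X in _ - X](expect_cst (diid mu n)) -expectB.
rewrite -[X in _ == X](@expect_diid_sum _ mu (fun x => (a x)%:R - p) n).
  by apply/eqP; apply: eq_expect => t; rewrite sum_centered_count size_tuple.
by rewrite expectB expect_cst subrr.
Qed.

(** An indicator minus its mean lies in [[-1, 1]], so each of the [n] summands has variance at most
    1. *)
Lemma expect_count_sqr_dev n :
  expect (diid mu n) (fun t => ((count a t)%:R - n%:R * p) ^+ 2) <= n%:R.
Proof.
under eq_expect => t do rewrite -[X in X%:R * _](size_tuple t) -sum_centered_count.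
rewrite expect_diid_sum_sqr; last by rewrite expectB expect_cst subrr.
rewrite -[leRHS]mulr1 ler_wpM2l// -[leRHS](expect_cst mu); apply: le_expect => x.
have p0 : 0 <= p by rewrite -(expect_cst mu 0); apply: le_expect => y.
have p1 : p <= 1.
  by rewrite -[leRHS](expect_cst mu 1); apply: le_expect => y; case: (a y) => //; exact: ler01.
by case: (a x) => /=; nra.
Qed.

(** The first absolute moment is reduced to the second, which is at most [n]; the weight
    [r = sqrt n] balances the two halves, each contributing [r / 2]. *)
Lemma expect_count_dev n :
  expect (diid mu n) (fun t => `|(count a t)%:R - n%:R * p|) <= Num.sqrt n%:R.
Proof.
case: n => [|n]; first by rewrite expect_dret /= mul0r subr0 normr0 sqrtr0.
set r := Num.sqrt _; have r0 : 0 < r by rewrite sqrtr_gt0 ltr0n.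
have rr : r * r = n.+1%:R by rewrite -expr2 sqr_sqrtr.
(* AM-GM: [2 r |y| <= y^2 + r^2] *)
have h y : `|y| <= (2 * r)^-1 * y ^+ 2 + r / 2.
  rewrite -(ler_pM2l (mulr_gt0 (ltr0Sn R 1) r0)) mulrDr mulrA mulfV ?mulf_neq0 ?gt_eqF//.
  by rewrite -real_normK ?num_real//; have := sqr_ge0 (`|y| - r); nra.
apply: le_trans (le_expect _ (fun t => h _)) _.
rewrite expectD expect_cst expectZ.
have := expect_count_sqr_dev n.+1; rewrite -rr => hn.
rewrite -(ler_pM2l (mulr_gt0 (ltr0Sn R 1) r0)) mulrDr mulrA mulfV ?mulf_neq0 ?gt_eqF//.
by move: hn; lra.
Qed.

End Counting.

(** Hybrid argument: the law of the tail is exchanged pointwise, by induction, and then that of the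
    head. Each of the [s] exchanges costs [C * d], since [d] is calibrated on test functions bounded
    by 1. *)
Lemma expect_diid_close T (mu nu : distr R T) (d : R) s (f : s.-tuple T -> R) C :
  (forall g, (forall x, `|g x| <= 1) -> `|expect mu g - expect nu g| <= d) ->
  0 < C -> (forall t, `|f t| <= C) ->
  `|expect (diid mu s) f - expect (diid nu s) f| <= s%:R * (C * d).
Proof.
move=> hd C0; elim: s f => [|s IHs] f fC.
  by rewrite !expect_dret subrr normr0 mul0r.
rewrite !expect_diid_cons.
set F := fun x => expect (diid mu s) _; set G := fun x => expect (diid nu s) _.
have -> : expect mu F - expect nu G =
    expect mu (fun x => F x - G x) + (expect mu G - expect nu G).
  by rewrite expectB; ring.
rewrite -natr1 mulrDl mul1r; apply: le_trans (ler_normD _ _) (lerD _ _).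
  by apply: expect_norm_le => x; apply: IHs.
have hG x : `|C^-1 * G x| <= 1.
  rewrite normrM gtr0_norm ?invr_gt0// mulrC ler_pdivrMr// mul1r.
  exact: expect_norm_le.
have -> : expect mu G - expect nu G =
    C * (expect mu (fun x => C^-1 * G x) - expect nu (fun x => C^-1 * G x)).
  by rewrite !expectZ -mulrBr mulrA mulfV ?mul1r// gt_eqF.
by rewrite normrM gtr0_norm// ler_pM2l//; apply: hd.
Qed.

Lemma expect_diid_map T U (mu : distr R T) (nu : distr R U) (h : T -> U) s f :
  (forall g, expect mu (g \o h) = expect nu g) ->
  expect (diid mu s) (fun t => f [tuple of [seq h x | x <- t]]) =
  expect (diid nu s) f.
Proof.
move=> hh; elim: s f => [|s IHs] f.
  by rewrite !expect_dret; congr f; apply: val_inj.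
rewrite !expect_diid_cons -hh; apply: eq_expect => x /=.
rewrite -IHs; apply: eq_expect => t; congr f; exact: val_inj.
Qed.

End Expectation.

(** * Degrees of the constructed graph *)

Lemma map_change_first T U (h : T -> U) a b f g m (s : seq T) :
  (forall x, a x = b (h x)) -> (forall x, h (f x) = g (h x)) ->
  [seq h x | x <- change_first a f m s] = change_first b g m [seq h x | x <- s].
Proof.
move=> ab fg; elim: s m => [|x s IHs] [|m] //=.
by rewrite -ab; case: ifP => _ /=; rewrite IHs ?fg.
Qed.

Lemma map_change_first_id T U (h : T -> U) a f m (s : seq T) :
  (forall x, h (f x) = h x) ->
  [seq h x | x <- change_first a f m s] = [seq h x | x <- s].
Proof.
move=> hf; elim: s m => [|x s IHs] [|m] //=.
by case: ifP => _ /=; rewrite IHs ?hf.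
Qed.

(** * Raising zero degrees to prescribed values *)

Section FillingZeros.
Local Open Scope nat_scope.
Variable d : nat -> nat.

(** The trace of [set_outdegs] and of [set_indegs] on the one coordinate that each of them tests and
    modifies. *)
Definition fill_zeros (ks s : seq nat) : seq nat :=
  foldl (fun s k => change_first (fun x => x == 0) (fun=> k) (d k) s) s ks.

(** There are enough zeros for all [m] changes to take place. The balance is stated additively to
    avoid truncated subtraction. *)
Lemma count_change_first (k m : nat) (s : seq nat) (i : nat) : k != 0 -> m <= count_mem 0 s ->
  count_mem i (change_first (fun x => x == 0) (fun=> k) m s) + (i == 0) * m =
  count_mem i s + (i == k) * m.
Proof.
move=> k0; elim: s m => [|x s IHs] [|m] //=; rewrite ?muln0// => hm; move: hm.
case: eqP => [->|/eqP x0] /=.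
  move=> hm.
  have /IHs := hm; rewrite (eq_sym 0 i) (eq_sym k i).
  case: (i == 0) (i == k) => [] [];
    move: (count _ s) (count _ (change_first _ _ _ _)) => u w; lia.
by rewrite add0n => /IHs /=; rewrite -!addnA => ->.
Qed.

(** Each round uses up exactly [d k] zeros, so room for the total demand at the start leaves room
    for every later round. As [0] is not in [ks], no entry is changed twice. *)
Lemma count_fill_zeros (ks s : seq nat) (i : nat) : 0 \notin ks ->
  \sum_(k <- ks) d k <= count_mem 0 s -> i != 0 ->
  count_mem i (fill_zeros ks s) = count_mem i s + \sum_(k <- ks) (i == k) * d k.
Proof.
move=> + + i0; elim: ks s => [|k ks IHks] s /=; first by rewrite !big_nil addn0.
rewrite inE negb_or eq_sym => /andP[k0 ks0]; rewrite !big_cons => hs.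
have hk : d k <= count_mem 0 s by apply: leq_trans (leq_addr _ _) hs.
rewrite IHks//.
  have := count_change_first i k0 hk.
  by rewrite (negbTE i0) mul0n addn0 => ->; rewrite addnA.
have := count_change_first 0 k0 hk.
rewrite eqxx (eq_sym 0) (negbTE k0) mul1n mul0n addn0 => h.
by rewrite -(leq_add2r (d k)) h addnC.
Qed.

(** The factor [i <= K] also covers large [i]: it shows that no degree above [K] is created. *)
Lemma count_fill_zeros_iota K n i :
  \sum_(1 <= k < K.+1) d k <= n -> 0 < i ->
  count_mem i (fill_zeros (iota 1 K) (nseq n 0)) = (i <= K) * d i.
Proof.
move=> hn i0.
rewrite count_fill_zeros -?lt0n//.
- rewrite count_nseq /= eq_sym (negbTE (lt0n_neq0 i0)) mul0n add0n.
  case: (leqP i K) => iK.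
    rewrite mul1n (bigD1_seq i) ?iota_uniq//=; last by rewrite mem_iota i0 add1n ltnS.
    rewrite eqxx mul1n big1 ?addn0// => k.
    by rewrite eq_sym => /negbTE ->.
  rewrite mul0n big_seq big1// => k; rewrite mem_iota add1n ltnS => /andP[_ kK].
  by rewrite gtn_eqF// (leq_ltn_trans kK).
- by rewrite mem_iota.
- by rewrite count_nseq mul1n; move: hn; rewrite /index_iota subn1.
Qed.

Lemma size_fill_zeros ks s : size (fill_zeros ks s) = size s.
Proof.
elim: ks s => //= k ks IHks s; rewrite IHks.
by elim: s (d k) => [|x s IHs] [|m] //=; case: ifP => /= _; rewrite IHs.
Qed.

End FillingZeros.

(** * Dealing out one end of the edges, for tails and heads alike *)

Section Dealing.
Local Open Scope nat_scope.
Variables (K n m : nat) (a b : nat -> nat) (sigma : nat -> seq nat).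
Let nodes k := [seq v <- iota 1 n | a v == k].
Let half_edges k := [seq e <- iota 0 m | b e == k].
Hypothesis b_bound : forall e, e < m -> 1 <= b e <= K.
Hypothesis a_bound : forall v, 1 <= v <= n -> a v <= K.
Hypothesis matching : forall k, 1 <= k <= K -> k * size (nodes k) = size (half_edges k).
Hypothesis sigma_perm : forall k, 1 <= k <= K -> perm_eq (sigma k) (half_edges k).

Lemma size_flatten_nseq (d : nat) (vs : seq nat) :
  size (flatten [seq nseq d v | v <- vs]) = d * size vs.
Proof. by elim: vs => [|v vs /= IHvs]; rewrite ?muln0//= size_cat size_nseq IHvs mulnS. Qed.

Lemma count_flatten_nseq (d : nat) (vs : seq nat) v :
  count_mem v (flatten [seq nseq d w | w <- vs]) = d * count_mem v vs.
Proof.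
elim: vs => [|w vs /= IHvs]; rewrite ?muln0//= count_cat count_nseq IHvs mulnDr /=.
by rewrite mulnC.
Qed.

Lemma mem_flatten_nseq (d : nat) (vs : seq nat) v :
  v \in flatten [seq nseq d w | w <- vs] -> v \in vs.
Proof. by case/flattenP => s /mapP[w wvs ->] /nseqP[-> _]. Qed.

Let tail e := dealt_to (b e) (nodes (b e)) (sigma (b e)) e.

(** By [matching] there are as many slots as half-edges of the given label, so the index of [e] in
    [sigma] falls on a slot and [nth] never returns its default. *)
Lemma mem_dealt_to e : e < m -> tail e \in nodes (b e).
Proof.
move=> em; have be := b_bound em; apply: mem_flatten_nseq (mem_nth _ _).
rewrite size_flatten_nseq matching// -(perm_size (sigma_perm be)) index_mem.
by rewrite (perm_mem (sigma_perm be)) mem_filter eqxx mem_iota add0n em.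
Qed.

(** Only edges labelled [a v] can land on [v]. Read in the order [sigma (a v)], their receivers
    spell out the list of slots, where [v] occurs [a v] times whatever the order is. *)
Lemma count_dealt_to v : 1 <= v <= n -> count (fun e => tail e == v) (iota 0 m) = a v.
Proof.
move=> hv; have vn : v \in iota 1 n by rewrite mem_iota add1n ltnS.
have -> : count (fun e => tail e == v) (iota 0 m) =
    count (fun e => tail e == v) (half_edges (a v)).
  rewrite count_filter; apply: eq_in_count => e; rewrite mem_iota add0n /= => em.
  case: eqP => //= te; apply/esym; move: (mem_dealt_to em).
  by rewrite te mem_filter eq_sym => /andP[].
(* Degree 0 is separate because [sigma] and [matching] only concern labels from 1 on; no edge
   carries the label 0. *)
have [->|av0] := posnP (a v).
  suff -> : half_edges 0 = [::] by [].
  rewrite -(filter_pred0 (iota 0 m)); apply: eq_in_filter => e.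
  by rewrite mem_iota add0n => /b_bound /andP[+ _] /=; rewrite lt0n => /negbTE.
have av : 1 <= a v <= K by rewrite av0 a_bound.
have hp := sigma_perm av.
rewrite (@eq_in_count _ _
    (fun e => dealt_to (a v) (nodes (a v)) (sigma (a v)) e == v)); last first.
  by move=> e; rewrite mem_filter => /andP[/eqP <- _].
rewrite -(permP hp) -(count_map _ (pred1 v)).
have -> : [seq dealt_to (a v) (nodes (a v)) (sigma (a v)) e | e <- sigma (a v)] =
    flatten [seq nseq (a v) w | w <- nodes (a v)].
  have hs : size (sigma (a v)) = a v * size (nodes (a v)).
    by rewrite (perm_size hp) matching.
  apply: (@eq_from_nth _ 0); rewrite size_map; first by rewrite size_flatten_nseq.
  move=> i hi; rewrite (nth_map 0)// /dealt_to index_uniq//.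
  by rewrite (perm_uniq hp) filter_uniq// iota_uniq.
rewrite count_flatten_nseq count_uniq_mem ?filter_uniq ?iota_uniq//.
by rewrite mem_filter eqxx vn muln1.
Qed.

End Dealing.

Lemma map_nth_iota1 (T : Type) (x0 : T) (s : seq T) :
  [seq nth x0 s v.-1 | v <- iota 1 (size s)] = s.
Proof.
rewrite (iotaDl 1 0) -map_comp /=; exact: mkseq_nth.
Qed.

(** The dealing argument is applied to tails and to heads. Node degrees are then the prescribed
    ones, and an edge labelled [(k, j)] starts at a node prescribed [k] and ends at one prescribed
    [j], so its label is its actual type. *)
Lemma allocate_types (R : realType) (J K : nat) (nt et : seq (nat * nat)) :
  (forall k, (1 <= k <= K)%N -> (k * n_out nt k)%N = m_out et k) ->
  (forall j, (1 <= j <= J)%N -> (j * n_in nt j)%N = m_in et j) ->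
  all (fun t => (t.1 <= J) && (t.2 <= K))%N nt ->
  all (fun t => (1 <= t.1 <= K) && (1 <= t.2 <= J))%N et ->
  surely (allocate R J K nt et) (fun g =>
    [seq node_type g v | v <- iota 1 (nb_nodes g)] = nt /\
    [seq edge_type g e | e <- edges g] = et).
Proof.
move=> hout hin /allP ntP /allP etP.
have unif_perm (es : seq nat) :
    surely (dunif R [::] (permutations es)) (fun s => perm_eq s es).
  apply: (@surely_sub _ _ _ (fun s => s \in permutations es)) => [s|].
    by rewrite mem_permutations.
  (* The list of permutations contains [es], so it is nonempty and [dunif] does not fall back on its
     default. *)
  apply: surely_dunif; have := mem_permutations es es.
  by rewrite perm_refl; case: (permutations es).
have nodeP v : (1 <= v <= size nt)%N ->
    ((nth (0, 0) nt v.-1).1 <= J)%N && ((nth (0, 0) nt v.-1).2 <= K)%N.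
  by move=> /andP[v1 vn]; apply: ntP; rewrite mem_nth// prednK.
have edgeP e : (e < size et)%N -> (1 <= (nth (0, 0) et e).1 <= K)%N &&
    (1 <= (nth (0, 0) et e).2 <= J)%N.
  by move=> em; apply: etP; rewrite mem_nth.
have sizes_out k : (1 <= k <= K)%N -> (k * size (nodes_out nt k))%N = size (edges_out et k).
  move=> hk; have := hout k hk; rewrite /n_out /m_out !size_filter.
  rewrite -{1}(map_nth_iota1 (0, 0)%N nt) count_map.
  by rewrite -{1}(mkseq_nth (0, 0)%N et) count_map.
have sizes_in j : (1 <= j <= J)%N -> (j * size (nodes_in nt j))%N = size (edges_in et j).
  move=> hj; have := hin j hj; rewrite /n_in /m_in !size_filter.
  rewrite -{1}(map_nth_iota1 (0, 0)%N nt) count_map.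
  by rewrite -{1}(mkseq_nth (0, 0)%N et) count_map.
have sigma_surely := @surely_dprod_iota R _ [::] _ _ 1 K
  (fun k _ => unif_perm (edges_out et k)).
have tau_surely := @surely_dprod_iota R _ [::] _ _ 1 J
  (fun j _ => unif_perm (edges_in et j)).
apply: surely_dbind sigma_surely _ => sigma hsigma.
apply: surely_dbind tau_surely _ => tau htau; apply: surely_dret.
have sigmaP k : (1 <= k <= K)%N -> perm_eq (nth [::] sigma k.-1) (edges_out et k).
  by rewrite -subn1 -ltnS; apply: hsigma.
have tauP k : (1 <= k <= J)%N -> perm_eq (nth [::] tau k.-1) (edges_in et k).
  by rewrite -subn1 -ltnS; apply: htau.
have edge1 e : (e < size et)%N -> _ := fun he => proj1 (andP (edgeP e he)).
have edge2 e : (e < size et)%N -> _ := fun he => proj2 (andP (edgeP e he)).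
have node1 v : (1 <= v <= size nt)%N -> _ := fun hv => proj1 (andP (nodeP v hv)).
have node2 v : (1 <= v <= size nt)%N -> _ := fun hv => proj2 (andP (nodeP v hv)).
have out_deg := count_dealt_to edge1 node2 sizes_out sigmaP.
have in_deg := count_dealt_to edge2 node1 sizes_in tauP.
have mem_tail := mem_dealt_to edge1 sizes_out sigmaP.
have mem_head := mem_dealt_to edge2 sizes_in tauP.
set g := Digraph _ _; split; last first.
  rewrite -[RHS](mkseq_nth (0, 0)%N) -map_comp; apply/eq_in_map => e.
  rewrite mem_iota add0n => /= em; rewrite /edge_type /outdeg /indeg !count_map.
  have := mem_tail e em; rewrite mem_filter mem_iota add1n ltnS => /andP[/eqP t1 t2].
  have := mem_head e em; rewrite mem_filter mem_iota add1n ltnS => /andP[/eqP h1 h2].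
  rewrite [RHS]surjective_pairing; congr (_, _).
    by rewrite -[RHS]t1; exact: out_deg.
  by rewrite -[RHS]h1; exact: in_deg.
rewrite -[RHS](map_nth_iota1 (0, 0)%N); apply/eq_in_map => v.
rewrite mem_iota add1n ltnS => /= hv; rewrite /node_type /outdeg /indeg !count_map.
rewrite [RHS]surjective_pairing; congr (_, _); first exact: in_deg.
exact: out_deg.
Qed.

Section NatCeil.
Variable R : realType.

Lemma natceil_ge (x : R) : 0 <= x -> x <= (natceil x)%:R.
Proof.
move=> x0; rewrite /natceil natr_absz ger0_norm; first exact: ceil_ge.
by rewrite ceil_ge0 (lt_le_trans _ x0)// ltrN10.
Qed.

Lemma natceil_lt (x : R) : 0 <= x -> (natceil x)%:R < x + 1.
Proof.
move=> x0; rewrite /natceil natr_absz ger0_norm.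
  by have := ceilB1_lt x; rewrite intrD mulrN1z ltrBlDr.
by rewrite ceil_ge0 (lt_le_trans _ x0)// ltrN10.
Qed.

Lemma ceil_frac_ge (k m : nat) : (0 < k)%N -> (m <= k * natceil (k%:R^-1 * m%:R : R))%N.
Proof.
move=> k0; rewrite -(ler_nat R) natrM -ler_pdivrMl ?ltr0n//.
by apply: natceil_ge; rewrite mulr_ge0// invr_ge0.
Qed.

Lemma ceil_frac_excess (k m : nat) :
  (0 < k)%N -> (k * natceil (k%:R^-1 * m%:R : R) - m <= k)%N.
Proof.
move=> k0; rewrite leq_subLR -(ler_nat R) natrM natrD.
have kR : 0 < k%:R :> R by rewrite ltr0n.
have h : (natceil (k%:R^-1 * m%:R : R))%:R <= k%:R^-1 * m%:R + 1 :> R.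
  by apply/ltW/natceil_lt; rewrite mulr_ge0// invr_ge0.
rewrite -(ler_pM2l kR) in h; apply: le_trans h _.
by rewrite mulrDr mulr1 mulVKf ?gt_eqF.
Qed.

End NatCeil.

Section Matching.
Variables (R : realType) (J K : nat).
Hypotheses (hJ : (1 <= J)%N) (hK : (1 <= K)%N).

Lemma sum_nat_delta (F : nat -> nat) K' k : (1 <= k <= K')%N ->
  (\sum_(1 <= i < K'.+1) (i == k) * F i = F k)%N.
Proof.
case/andP=> k1 kK; rewrite (bigD1_seq k) ?iota_uniq//=; last first.
  by rewrite mem_index_iota k1 ltnS.
by rewrite eqxx mul1n big1 ?addn0// => i /negbTE ->.
Qed.

Lemma count_flatten_nseq_map (a : pred (nat * nat)) (r : nat -> nat) F n :
  count a (flatten [seq nseq (r k) (F k) | k <- iota 1 n]) =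
  (\sum_(1 <= k < n.+1) a (F k) * r k)%N.
Proof.
rewrite count_flatten sumnE -map_comp big_map /index_iota subn1.
by apply: eq_bigr => k _; rewrite /= count_nseq.
Qed.

Lemma r_out_le et k : (1 <= k <= K)%N -> (r_out R et k <= K)%N.
Proof. by case/andP => k1 kK; apply: leq_trans kK; apply: ceil_frac_excess. Qed.

Lemma r_in_le et j : (1 <= j <= J)%N -> (r_in R et j <= J)%N.
Proof. by case/andP => j1 jJ; apply: leq_trans jJ; apply: ceil_frac_excess. Qed.

(** Origin of [J ^ 2] and [K ^ 2]: rounding up to a multiple of [i] adds at most [i] edges, for each
    of the [n] degrees. *)
Lemma sum_nat_bound (r : nat -> nat) n : (forall i, (1 <= i <= n)%N -> (r i <= n)%N) ->
  (\sum_(1 <= i < n.+1) r i <= n ^ 2)%N.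
Proof.
move=> hr; apply: (@leq_trans (\sum_(1 <= i < n.+1) n)%N); last first.
  by rewrite sum_nat_const_nat subn1.
by rewrite big_nat [leqRHS]big_nat; apply: leq_sum => i; rewrite ltnS; apply: hr.
Qed.

(** The edges that round the out-labels complete [m_out] to [k * e_out]. Those that round the
    in-labels all have out-label 1, whence the extra term at [k = 1], matched by as many added nodes
    of out-degree 1. *)
Lemma m_out_all_edge_types et k : (1 <= k <= K)%N ->
  m_out (all_edge_types R J K et) k =
  (k * (e_out R et k) + (k == 1) * \sum_(1 <= j < J.+1) r_in R et j)%N.
Proof.
move=> hk; rewrite /m_out /all_edge_types !count_cat !count_flatten_nseq_map /=.
rewrite sum_nat_delta// addnA subnKC; last by case/andP: hk => k0 _; apply: ceil_frac_ge.
by rewrite big_distrr /= (eq_sym k).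
Qed.

Lemma m_in_all_edge_types et j : (1 <= j <= J)%N ->
  m_in (all_edge_types R J K et) j =
  (j * (e_in R et j) + (j == 1) * \sum_(1 <= k < K.+1) r_out R et k)%N.
Proof.
move=> hj; rewrite /m_in /all_edge_types !count_cat !count_flatten_nseq_map /=.
rewrite sum_nat_delta// addnCA addnC subnKC; last first.
  by case/andP: hj => j0 _; apply: ceil_frac_ge.
by rewrite big_distrr /= (eq_sym j).
Qed.

Lemma size_extra_edges et :
  (size (flatten [seq nseq (r_out R et k) (k, 1%N) | k <- iota 1 K]
     ++ flatten [seq nseq (r_in R et j) (1%N, j) | j <- iota 1 J]) <= K ^ 2 + J ^ 2)%N.
Proof.
rewrite -[size _](count_predT) count_cat !count_flatten_nseq_map.
apply: leq_add; apply: leq_trans (sum_nat_bound _).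
- by apply: leq_sum => k _; rewrite mul1n.
- exact: r_out_le.
- by apply: leq_sum => k _; rewrite mul1n.
- exact: r_in_le.
Qed.

Lemma mem_edge_types t : (t \in edge_types J K) = (1 <= t.1 <= K)%N && (1 <= t.2 <= J)%N.
Proof.
apply/allpairsP/idP => [[u [u1 u2 ->]]|/andP[t1 t2]].
  by move: u1 u2; rewrite !mem_iota !add1n !ltnS => ->.
by exists t; rewrite !mem_iota !add1n !ltnS -surjective_pairing.
Qed.

Lemma mem_node_types t : (t \in node_types J K) = (t.1 <= J)%N && (t.2 <= K)%N.
Proof.
apply/allpairsP/idP => [[u [u1 u2 ->]]|/andP[t1 t2]].
  by move: u1 u2; rewrite !mem_iota !add0n !ltnS => /andP[_ ->].
by exists t; rewrite !mem_iota !add0n !ltnS -surjective_pairing.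
Qed.

Lemma all_edge_types_bound et : all (mem (edge_types J K)) et ->
  all (fun t => (1 <= t.1 <= K) && (1 <= t.2 <= J))%N (all_edge_types R J K et).
Proof.
move=> /allP etP; apply/allP => t; rewrite !mem_cat => /or3P[/etP|/flattenP[s]|/flattenP[s]].
- by rewrite inE mem_edge_types.
- move=> /mapP[k]; rewrite mem_iota add1n ltnS => hk -> /nseqP[-> _].
  by rewrite hk hJ.
- move=> /mapP[k]; rewrite mem_iota add1n ltnS => hk -> /nseqP[-> _].
  by rewrite hk hK.
Qed.

Lemma map_set_outdegs nt et ts : [seq t.2 | t <- set_outdegs R J K nt et ts] =
  fill_zeros (fun k => e_out R et k - n_out nt k
    + (if k == 1 then \sum_(1 <= j < J.+1) r_in R et j else 0))%N
    (iota 1 K) [seq t.2 | t <- ts].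
Proof.
rewrite /set_outdegs /fill_zeros; elim: (iota 1 K) ts => //= k ks IHks ts.
by rewrite IHks (map_change_first _ (b := fun x => x == 0%N) (g := fun=> k)).
Qed.

Lemma map_set_outdegs_in nt et ts :
  [seq t.1 | t <- set_outdegs R J K nt et ts] = [seq t.1 | t <- ts].
Proof.
rewrite /set_outdegs; elim: (iota 1 K) ts => //= k ks IHks ts.
by rewrite IHks; apply: map_change_first_id.
Qed.

Lemma map_set_indegs nt et ts : [seq t.1 | t <- set_indegs R J K nt et ts] =
  fill_zeros (fun j => e_in R et j - n_in nt j
    + (if j == 1 then \sum_(1 <= k < K.+1) r_out R et k else 0))%N
    (iota 1 J) [seq t.1 | t <- ts].
Proof.
rewrite /set_indegs /fill_zeros; elim: (iota 1 J) ts => //= k ks IHks ts.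
by rewrite IHks (map_change_first _ (b := fun x => x == 0%N) (g := fun=> k)).
Qed.

Lemma map_set_indegs_out nt et ts :
  [seq t.2 | t <- set_indegs R J K nt et ts] = [seq t.2 | t <- ts].
Proof.
rewrite /set_indegs; elim: (iota 1 J) ts => //= k ks IHks ts.
by rewrite IHks; apply: map_change_first_id.
Qed.

Lemma size_extra_nodes nt et n :
  size (set_indegs R J K nt et (set_outdegs R J K nt et (nseq n (0, 0)%N))) = n.
Proof.
by rewrite -(size_map snd) map_set_indegs_out map_set_outdegs size_fill_zeros
  size_map size_nseq.
Qed.

Lemma fill_zeros_le d m n k :
  (\sum_(1 <= i < m.+1) d i <= n)%N -> k \in fill_zeros d (iota 1 m) (nseq n 0%N) ->
  (k <= m)%N.
Proof.
move=> hd; rewrite -has_pred1 has_count; case: k => // k.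
rewrite (count_fill_zeros_iota hd)//.
by case: (k < m)%N.
Qed.

Variables (P : nat * nat -> R).
Hypothesis hP : is_pmf (node_types J K) P.

Lemma sum_delta (F : nat -> R) m n k : (m <= k < m + n)%N ->
  \sum_(i <- iota m n) F i * (i == k)%:R = F k.
Proof.
move=> hk; rewrite (bigD1_seq k) ?iota_uniq ?mem_iota//=.
rewrite eqxx mulr1 big1 ?addr0// => i /negbTE ->.
by rewrite mulr0.
Qed.

Lemma p_outE k : (k <= K)%N -> p_out J P k = expect (dpmf hP) (fun t => (t.2 == k)%:R).
Proof.
move=> kK; rewrite expect_dpmf big_allpairs_dep /= /p_out /index_iota subn0.
by apply: eq_bigr => j _; rewrite -(@sum_delta (fun k => P (j, k)) 0 K.+1 k).
Qed.

Lemma p_inE j : (j <= J)%N -> p_in K P j = expect (dpmf hP) (fun t => (t.1 == j)%:R).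
Proof.
move=> jJ; rewrite expect_dpmf big_allpairs_dep /= /p_in /index_iota subn0.
rewrite exchange_big; apply: eq_bigr => k _.
by rewrite -(@sum_delta (fun j => P (j, k)) 0 J.+1 j).
Qed.

Lemma sum_indic_le1 n (k : nat) : \sum_(1 <= i < n.+1) (k == i)%:R <= 1 :> R.
Proof.
rewrite -natr_sum -[1]/(1%:R) ler_nat /index_iota subn1.
under eq_bigr => i _ do rewrite eq_sym.
rewrite -[X in (X <= _)%N]/(\sum_(i <- iota 1 n) nat_of_bool (pred1 k i))%N.
by rewrite -big_mkcond sum1_count count_uniq_mem ?iota_uniq// leq_b1.
Qed.

Lemma p_out_ge0 k : (k <= K)%N -> 0 <= p_out J P k.
Proof.
by move=> kK; rewrite p_outE// -(expect_cst (dpmf hP) 0); apply: le_expect => t.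
Qed.

Lemma p_in_ge0 j : (j <= J)%N -> 0 <= p_in K P j.
Proof.
by move=> jJ; rewrite p_inE// -(expect_cst (dpmf hP) 0); apply: le_expect => t.
Qed.

Lemma sum_p_out_le1 : \sum_(1 <= k < K.+1) p_out J P k <= 1.
Proof.
rewrite big_nat (eq_bigr (fun k => expect (dpmf hP) (fun t => (t.2 == k)%:R))); last first.
  by move=> k /andP[_]; rewrite ltnS; apply: p_outE.
rewrite -big_nat -expect_sum -[leRHS](expect_cst (dpmf hP)).
by apply: le_expect => t; apply: sum_indic_le1.
Qed.

Lemma sum_p_in_le1 : \sum_(1 <= j < J.+1) p_in K P j <= 1.
Proof.
rewrite big_nat (eq_bigr (fun j => expect (dpmf hP) (fun t => (t.1 == j)%:R))); last first.
  by move=> j /andP[_]; rewrite ltnS; apply: p_inE.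
rewrite -big_nat -expect_sum -[leRHS](expect_cst (dpmf hP)).
by apply: le_expect => t; apply: sum_indic_le1.
Qed.

(** The centers differ by [p k * sl] and the two tolerances sum to [p k * x], so [e k - n k] lies
    between [p k * (sl - x) >= 0] and [p k * (sl + x) <= 2 * p k * sl]. Summing over [k] uses that
    the [p k] add up to at most 1. *)
Lemma deficit_bound (n e : nat -> nat) (p : nat -> R) (x : R) (m sl d : nat) :
  (forall k, (1 <= k <= d)%N -> 0 <= p k) -> \sum_(1 <= k < d.+1) p k <= 1 ->
  x <= sl%:R ->
  (forall k, (1 <= k <= d)%N -> `|(n k)%:R - p k * m%:R| <= p k * x / 2) ->
  (forall k, (1 <= k <= d)%N -> `|(e k)%:R - p k * (m + sl)%N%:R| <= p k * x / 2) ->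
  (forall k, (1 <= k <= d)%N -> (n k <= e k)%N) /\
  (\sum_(1 <= k < d.+1) (e k - n k) <= 2 * sl)%N.
Proof.
move=> p0 p1 xs hn he.
have ne k : (1 <= k <= d)%N -> (n k <= e k)%N.
  move=> hk; rewrite -(ler_nat R).
  move: (hn k hk) (he k hk) (p0 k hk); rewrite !ler_norml natrD => /andP[_ h1] /andP[h2 _] h3.
  nra.
split=> //; rewrite -(ler_nat R) natr_sum natrM.
apply: (@le_trans _ _ (\sum_(1 <= k < d.+1) p k * (2 * sl%:R))); last first.
  by rewrite -mulr_suml ler_piMl// mulr_ge0.
rewrite big_nat [leRHS]big_nat; apply: ler_sum => k; rewrite ltnS => hk.
rewrite natrB ?ne//.
move: (hn k hk) (he k hk) (p0 k hk); rewrite !ler_norml natrD => /andP[h1 _] /andP[_ h2] h3.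
nra.
Qed.

Section Good.
Variables (delta : R) (N : nat) (nt et : seq (nat * nat)).
Hypothesis N_large : (2 * slack delta N + maxn (J ^ 2) (K ^ 2) <= N)%N.
Hypothesis nt_good : good J K P delta N nt et.
Hypothesis nt_types : all (mem (node_types J K)) nt.
Hypothesis et_types : all (mem (edge_types J K)) et.

Let slack_ge : N%:R `^ delta <= (slack delta N)%:R :> R.
Proof. by apply: natceil_ge; apply: powR_ge0. Qed.

Let out_deficit : (forall k, (1 <= k <= K)%N -> (n_out nt k <= e_out R et k)%N) /\
  (\sum_(1 <= k < K.+1) (e_out R et k - n_out nt k) <= 2 * slack delta N)%N.
Proof.
move/andP: nt_good => [/allP g _].
have {}g k : (1 <= k <= K)%N -> _ := fun hk => andP (g k (etrans (mem_iota 1 K k) hk)).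
apply: (deficit_bound (m := N1 J K delta N) _ sum_p_out_le1 slack_ge).
- by move=> k /andP[_]; apply: p_out_ge0.
- by move=> k /g[].
- by move=> k /g[].
Qed.

Let in_deficit : (forall j, (1 <= j <= J)%N -> (n_in nt j <= e_in R et j)%N) /\
  (\sum_(1 <= j < J.+1) (e_in R et j - n_in nt j) <= 2 * slack delta N)%N.
Proof.
move/andP: nt_good => [_ /allP g].
have {}g j : (1 <= j <= J)%N -> _ := fun hj => andP (g j (etrans (mem_iota 1 J j) hj)).
apply: (deficit_bound (m := N1 J K delta N) _ sum_p_in_le1 slack_ge).
- by move=> j /andP[_]; apply: p_in_ge0.
- by move=> j /g[].
- by move=> j /g[].
Qed.

Let extraN : (N - N1 J K delta N = 2 * slack delta N + maxn (J ^ 2) (K ^ 2))%N.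
Proof. by rewrite /N1 subKn. Qed.

(** The reserve splits as the demand does: [2 * slack] covers the deficits, and the maximum covers
    the rounding term, present only at [k = 1] and at most [J ^ 2]. *)
Let out_room : (\sum_(1 <= k < K.+1) (e_out R et k - n_out nt k
  + (if k == 1 then \sum_(1 <= j < J.+1) r_in R et j else 0)) <= N - N1 J K delta N)%N.
Proof.
rewrite big_split /= extraN leq_add ?out_deficit.2// (leq_trans _ (leq_maxl _ _))//.
rewrite big_ltn//= [X in (_ + X)%N]big_nat [X in (_ + X)%N]big1 ?addn0 => [|k /andP[k1 _]].
  exact: sum_nat_bound (@r_in_le et).
by rewrite gtn_eqF.
Qed.

Let in_room : (\sum_(1 <= j < J.+1) (e_in R et j - n_in nt j
  + (if j == 1 then \sum_(1 <= k < K.+1) r_out R et k else 0)) <= N - N1 J K delta N)%N.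
Proof.
rewrite big_split /= extraN leq_add ?in_deficit.2// (leq_trans _ (leq_maxr _ _))//.
rewrite big_ltn//= [X in (_ + X)%N]big_nat [X in (_ + X)%N]big1 ?addn0 => [|k /andP[k1 _]].
  exact: sum_nat_bound (@r_out_le et).
by rewrite gtn_eqF.
Qed.

Let outdegs_added : [seq t.2 | t <- all_node_types J K delta N nt et] =
  [seq t.2 | t <- nt] ++ fill_zeros (fun k => e_out R et k - n_out nt k
    + (if k == 1 then \sum_(1 <= j < J.+1) r_in R et j else 0))%N
    (iota 1 K) (nseq (N - N1 J K delta N) 0%N).
Proof. by rewrite map_cat map_set_indegs_out map_set_outdegs map_nseq. Qed.

Let indegs_added : [seq t.1 | t <- all_node_types J K delta N nt et] =
  [seq t.1 | t <- nt] ++ fill_zeros (fun j => e_in R et j - n_in nt j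
    + (if j == 1 then \sum_(1 <= k < K.+1) r_out R et k else 0))%N
    (iota 1 J) (nseq (N - N1 J K delta N) 0%N).
Proof. by rewrite map_cat map_set_indegs map_set_outdegs_in map_nseq. Qed.

Lemma allocate_good_types :
  surely (allocate R J K (all_node_types J K delta N nt et) (all_edge_types R J K et))
    (fun g =>
      [seq node_type g v | v <- iota 1 (nb_nodes g)] = all_node_types J K delta N nt et /\
      [seq edge_type g e | e <- edges g] = all_edge_types R J K et).
Proof.
apply: allocate_types; last exact: all_edge_types_bound.
- move=> k hk; rewrite m_out_all_edge_types//.
  have -> : n_out (all_node_types J K delta N nt et) k =
      count_mem k [seq t.2 | t <- all_node_types J K delta N nt et] by rewrite count_map.
  have [k0 kK] := andP hk.
  rewrite outdegs_added count_cat count_fill_zeros_iota// kK mul1n count_map.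
  rewrite -[count _ nt]/(n_out nt k) addnA subnKC ?out_deficit.1// mulnDr.
  (* The rounding term lives at [k = 1], so multiplication by [k] leaves it unchanged. *)
  by case: eqP => [->|_]; rewrite ?mul1n// mul0n muln0.
- move=> j hj; rewrite m_in_all_edge_types//.
  have -> : n_in (all_node_types J K delta N nt et) j =
      count_mem j [seq t.1 | t <- all_node_types J K delta N nt et] by rewrite count_map.
  have [j0 jJ] := andP hj.
  rewrite indegs_added count_cat count_fill_zeros_iota// jJ mul1n count_map.
  rewrite -[count _ nt]/(n_in nt j) addnA subnKC ?in_deficit.1// mulnDr.
  by case: eqP => [->|_]; rewrite ?mul1n// mul0n muln0.
have ntP t : t \in nt -> (t.1 <= J)%N && (t.2 <= K)%N.
  by move/(allP nt_types); rewrite inE mem_node_types.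
apply/allP => t ht; apply/andP; split.
  have := map_f fst ht; rewrite indegs_added mem_cat => /orP[/mapP[u /ntP/andP[u1 _] ->]//|].
  exact: fill_zeros_le.
have := map_f snd ht; rewrite outdegs_added mem_cat => /orP[/mapP[u /ntP/andP[_ u2] ->]//|].
exact: fill_zeros_le.
Qed.

End Good.
End Matching.

(** * Sampling error and the bad event *)

Section Sampling.
Variables (R : realType) (T : eqType) (S : seq T) (p : T -> R) (hp : is_pmf S p).
Hypothesis uniq_S : uniq S.

Lemma sum_count (l : seq T) (g : T -> R) : all (mem S) l ->
  \sum_(x <- l) g x = \sum_(x <- S) (count_mem x l)%:R * g x.
Proof.
elim: l => [|y l IHl] /=; first by rewrite big_nil big1 // => x _; rewrite mul0r.
case/andP=> yS /IHl {}IHl; rewrite big_cons IHl.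
under [RHS]eq_bigr => x _ do rewrite natrD mulrDl.
rewrite big_split /=; congr (_ + _).
rewrite (bigD1_seq y)//= eqxx mul1r big1 ?addr0// => x.
by rewrite eq_sym => /negbTE ->; rewrite mul0r.
Qed.

(** The limit mean is shared between [l] and [rest] in proportion to their sizes: [l] then
    contributes its empirical deviations, and each entry of [rest] at most 2. The denominator is
    lowered to [size l], which is deterministic when [l] is a sampled tuple. *)
Lemma expect_dunif_close (t0 : T) (l rest : seq T) (g : T -> R) :
  all (mem S) l -> (0 < size l)%N -> (forall x, `|g x| <= 1) ->
  `|expect (dunif R t0 (l ++ rest)) g - expect (dpmf hp) g| <=
  (2 * (size rest)%:R + \sum_(x <- S) `|(count_mem x l)%:R - (size l)%:R * p x|)
  / (size l)%:R.
Proof.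
move=> lS l0 g1; have lR : 0 < (size l)%:R :> R by rewrite ltr0n.
rewrite expect_dunif; last by rewrite size_cat ltn_addr.
set E := expect _ g; have E1 : `|E| <= 1 by apply: expect_norm_le.
rewrite size_cat natrD big_cat /= sum_count//.
set n := (size l)%:R in lR *; set r := (size rest)%:R.
have r0 : 0 <= r by rewrite ler0n.
have nr : 0 < n + r by rewrite ltr_wpDr.
set D := \sum_(x <- S) `|_|.
have D0 : 0 <= D by apply: sumr_ge0.
set A := \sum_(x <- S) _; set B := \sum_(x <- rest) _.
have hB : `|B| <= r.
  rewrite /B /r; elim: (rest) => [|x s IHs] /=; first by rewrite big_nil normr0.
  by rewrite big_cons -add1n natrD (le_trans (ler_normD _ _))// lerD.
have hA : `|A - n * E| <= D.
  have -> : A - n * E = \sum_(x <- S) ((count_mem x l)%:R - n * p x) * g x.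
    under [RHS]eq_bigr => x _ do rewrite mulrBl.
    rewrite sumrB /E expect_dpmf mulr_sumr; congr (_ - _).
    by apply: eq_bigr => x _; rewrite mulrA.
  apply: le_trans (ler_norm_sum _ _ _) _; apply: ler_sum => x _.
  by rewrite normrM ler_piMr.
have -> : (A + B) / (n + r) - E = ((A - n * E) + (B - r * E)) / (n + r).
  by field; rewrite gt_eqF.
rewrite normrM normfV (gtr0_norm nr) ler_pdivrMr//.
apply: (@le_trans _ _ (2 * r + D)).
  apply: le_trans (ler_normD _ _) _; rewrite addrC lerD//.
  apply: le_trans (ler_normB _ _) _; rewrite normrM (ger0_norm r0).
  have : r * `|E| <= r by rewrite ler_piMr.
  by move: hB; lra.
rewrite mulrAC ler_pdivlMr// ler_wpM2l//; last by rewrite lerDl.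
by rewrite addr_ge0// mulr_ge0.
Qed.

Lemma expect_sum_count_dev n :
  expect (diid (dpmf hp) n)
    (fun t => \sum_(x <- S) `|(count_mem x t)%:R - n%:R * p x|) <=
  (size S)%:R * Num.sqrt n%:R.
Proof.
have -> : (size S)%:R * Num.sqrt n%:R = \sum_(x <- S) Num.sqrt n%:R :> R.
  by rewrite big_const_seq count_predT iter_addr_0 mulr_natl.
rewrite expect_sum.
rewrite big_seq [leRHS]big_seq; apply: ler_sum => x xS.
have -> : p x = expect (dpmf hp) (fun y => (pred1 x y)%:R).
  rewrite expect_dpmf (bigD1_seq x)//= eqxx mulr1 big1 ?addr0// => y /negbTE ->.
  by rewrite mulr0.
exact: expect_count_dev.
Qed.

End Sampling.

(* Chebyshev's inequality; when [rho = 0] the junk value [8 / 0 ^+ 2 = 0] makes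
   the bound say that the deviation almost surely vanishes. *)
Lemma prob_dev_le (R : realType) (T : Type) (mu : distr R T) (a : pred T) M
    (Y : seq T -> nat) (rho c b x : R) :
  let p := expect mu (fun y => (a y)%:R) in
  0 <= rho -> 0 <= b -> 0 < x -> (rho = 0 -> p = 0) ->
  (forall t, count a t = 0%N -> Y t = 0%N) ->
  (forall t : M.-tuple T, `|(Y t)%:R - rho * c| <= `|(count a t)%:R - M%:R * p| + b) ->
  expect (diid mu M)
    (fun t => (~~ (`|(Y t)%:R - rho * c| <= rho * x / 2))%:R) <=
  8 / rho ^+ 2 * ((M%:R + b ^+ 2) / x ^+ 2).
Proof.
move=> p; rewrite le_eqVlt => /orP[/eqP <- b0 x0 /(_ erefl) p0 hY _|rho0 b0 x0 _ _ hY].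
  rewrite expr0n invr0 mulr0 mul0r.
  (* For [rho = 0] the tolerance is 0. The expected count is 0 as well, and the count, being an
     integer, dominates the indicator of [Y t != 0]. *)
  have := expect_count mu a M; rewrite -/p p0 mulr0 => h; rewrite -[leRHS]h.
  apply: le_expect => t; rewrite !mul0r subr0 normr_le0 pnatr_eq0.
  case: eqP => // /eqP Yt; rewrite ler1n lt0n; apply: contra Yt => /eqP/hY ->.
  exact: eqxx.
(* Outside the tolerance, [rho * x / 2 < w + b]; squaring with [(w + b)^2 <= 2 (w^2 + b^2)] gives
   the constant 8. *)
set K := 8 / (rho * x) ^+ 2.
have rx : 0 < rho * x by rewrite mulr_gt0.
have K0 : 0 <= K by rewrite divr_ge0// sqr_ge0.
have h (t : M.-tuple T) : (~~ (`|(Y t)%:R - rho * c| <= rho * x / 2))%:R <=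
    K * ((count a t)%:R - M%:R * p) ^+ 2 + K * b ^+ 2.
  have [_|hlt] := leP `|(Y t)%:R - rho * c| (rho * x / 2); first by apply: addr_ge0; apply: mulr_ge0 => //; apply: sqr_ge0.
  rewrite -mulrDr /K mulrAC ler_pdivlMr ?exprn_gt0// mul1r.
  rewrite -[X in _ <= 8 * (X + _)]real_normK ?num_real//.
  have := hY t; set u := `|_ - rho * c| in hlt *; set w := `|_ - M%:R * p| => uw.
  have w0 : 0 <= w by exact: normr_ge0.
  have : rho * x / 2 < w + b by apply: lt_le_trans uw.
  have := sqr_ge0 (w - b).
  move: (rho * x) rx => y y0; nra.
apply: le_trans (le_expect _ h) _; rewrite expectD expect_cst expectZ -mulrDr.
have -> : 8 / rho ^+ 2 * ((M%:R + b ^+ 2) / x ^+ 2) = K * (M%:R + b ^+ 2).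
  by rewrite /K; field; rewrite !gt_eqF.
by rewrite ler_wpM2l// lerD2r; apply: expect_count_sqr_dev.
Qed.

Lemma natr_negb_andb (R : realType) (a b : bool) : (~~ (a && b))%:R <= (~~ a)%:R + (~~ b)%:R :> R.
Proof. by case: a; case: b; rewrite /= ?addr0 ?add0r ?lerDl. Qed.

Lemma natr_negb_all (R : realType) T (a : pred T) s :
  (~~ all a s)%:R <= \sum_(x <- s) (~~ a x)%:R :> R.
Proof.
elim: s => [|x s IHs]; first by rewrite big_nil.
rewrite big_cons; apply: le_trans (natr_negb_andb _ _ _) _.
by rewrite lerD2l.
Qed.

(** * Probability of the complement of [good] *)

Section BadEvent.
Variables (R : realType) (J K : nat) (P Q : nat * nat -> R).
Hypotheses (hP : is_pmf (node_types J K) P) (hQ : is_pmf (edge_types J K) Q).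
Hypothesis hz : 0 < mean_degree J K P.
Hypotheses (hC1 : consistency1 J K P Q) (hC2 : consistency2 J K P Q).
Let z := mean_degree J K P.

Lemma q_outE k : (1 <= k <= K)%N ->
  q_out J Q k = expect (dpmf hQ) (fun t => (t.1 == k)%:R).
Proof.
move=> hk; rewrite expect_dpmf big_allpairs_dep /= /q_out /index_iota subn1.
rewrite exchange_big; apply: eq_bigr => j _.
by rewrite -(@sum_delta R (fun k => Q (k, j)) 1 K k).
Qed.

Lemma q_inE j : (1 <= j <= J)%N ->
  q_in K Q j = expect (dpmf hQ) (fun t => (t.2 == j)%:R).
Proof.
move=> hj; rewrite expect_dpmf big_allpairs_dep /= /q_in /index_iota subn1.
apply: eq_bigr => k _.
by rewrite -(@sum_delta R (fun j => Q (k, j)) 1 J j).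
Qed.

Variables (delta : R) (N : nat).
Hypothesis N_gt0 : (0 < N)%N.
Let x : R := N%:R `^ delta.
Let M := nb_edges J K P delta N.
Let x_gt0 : 0 < x. Proof. by apply: powR_gt0; rewrite ltr0n. Qed.
Let b : R := 1 + z^-1.
Let b_ge0 : 0 <= b. Proof. by rewrite addr_ge0// invr_ge0 ltW. Qed.

Let prob_dev_nodes (a : pred (nat * nat)) (rho : R) :
  rho = expect (dpmf hP) (fun t => (a t)%:R) -> 0 <= rho ->
  expect (diid (dpmf hP) (N1 J K delta N)) (fun t =>
    (~~ (`|(count a t)%:R - rho * (N1 J K delta N)%:R| <= rho * x / 2))%:R) <=
  8 / rho ^+ 2 * ((N1 J K delta N)%:R / x ^+ 2).
Proof.
move=> hrho rho0.
have := @prob_dev_le R _ (dpmf hP) a (N1 J K delta N) (count a) rho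
  (N1 J K delta N)%:R 0 x.
rewrite -hrho expr0n addr0; apply => // t.
by rewrite addr0 [rho * _]mulrC.
Qed.

(** Three errors add up: rounding [m / d] costs at most 1; the sampling deviation is divided by
    [d >= 1]; rounding the number of edges costs at most 1, scaled by [rho / z]. The first and third
    make up [b]. The center [d * rho / z] is the label probability given by (C1) or (C2). *)
Let ceil_frac_dev (d m : nat) (rho : R) : (0 < d)%N -> 0 <= rho -> rho <= 1 ->
  `|(natceil (d%:R^-1 * m%:R : R))%:R - rho * (N2 J K delta N)%:R| <=
  `|m%:R - M%:R * (d%:R * rho / z)| + b.
Proof.
move=> d0 rho0 rho1.
have dR : 1 <= d%:R :> R by rewrite ler1n.
have d1 : d%:R^-1 <= 1 :> R by rewrite invf_le1 ?ltr0n.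
have dm0 : 0 <= d%:R^-1 * m%:R :> R by rewrite mulr_ge0// invr_ge0.
set A := (natceil _)%:R; set n2 := (N2 J K delta N)%:R.
have hA : `|A - d%:R^-1 * m%:R| <= 1.
  rewrite ger0_norm ?subr_ge0 ?natceil_ge// lerBlDl addrC.
  by rewrite ltW// addrC natceil_lt.
have zn : 0 <= z * n2 by rewrite mulr_ge0// ltW.
have hM : `|M%:R - z * n2| <= 1.
  rewrite ger0_norm ?subr_ge0 ?natceil_ge// lerBlDl addrC.
  by rewrite ltW// addrC natceil_lt.
have z0 : z != 0 by rewrite gt_eqF.
have dn0 : d%:R != 0 :> R by rewrite pnatr_eq0 -lt0n.
have -> : A - rho * n2 = (A - d%:R^-1 * m%:R) +
    (d%:R^-1 * (m%:R - M%:R * (d%:R * rho / z)) + rho * z^-1 * (M%:R - z * n2)).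
  by field; rewrite z0 dn0.
apply: le_trans (ler_normD _ _) _.
have h1 : `|d%:R^-1 * (m%:R - M%:R * (d%:R * rho / z))| <= `|m%:R - M%:R * (d%:R * rho / z)|.
  by rewrite normrM gtr0_norm ?invr_gt0 ?ltr0n// ler_piMl.
have h2 : `|rho * z^-1 * (M%:R - z * n2)| <= z^-1.
  rewrite !normrM (ger0_norm rho0) gtr0_norm ?invr_gt0// -mulrA mulrCA.
  by rewrite ler_piMr ?invr_ge0 ?(ltW hz)// mulr_ile1.
apply: le_trans (lerD hA (le_trans (ler_normD _ _) (lerD h1 h2))) _.
by rewrite /b; lra.
Qed.

Let prob_dev_edges (a : pred (nat * nat)) (d : nat) (rho : R) :
  (0 < d)%N -> 0 <= rho -> rho <= 1 ->
  expect (dpmf hQ) (fun t => (a t)%:R) = d%:R * rho / z ->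
  expect (diid (dpmf hQ) M) (fun t =>
    (~~ (`|(natceil (d%:R^-1 * (count a t)%:R : R))%:R - rho * (N2 J K delta N)%:R|
        <= rho * x / 2))%:R) <=
  8 / rho ^+ 2 * ((M%:R + b ^+ 2) / x ^+ 2).
Proof.
move=> d0 rho0 rho1 hq.
apply: (@prob_dev_le R _ (dpmf hQ) a M
  (fun t => natceil (d%:R^-1 * (count a t)%:R : R))) => //.
- by move=> r0; rewrite hq r0 mulr0 mul0r.
- by move=> t ->; rewrite mulr0 /natceil ceil0.
- by move=> t; rewrite hq; apply: ceil_frac_dev.
Qed.

(** Degrees of probability zero contribute [8 / 0 = 0], in accordance with [prob_dev_le]. *)
Definition bad_const : R :=
  \sum_(k <- iota 1 K) 8 / p_out J P k ^+ 2 +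
  \sum_(j <- iota 1 J) 8 / p_in K P j ^+ 2.

Lemma bad_const_ge0 : 0 <= bad_const.
Proof. by rewrite addr_ge0// sumr_ge0// => i _; rewrite divr_ge0// sqr_ge0. Qed.

Lemma p_out_le1 k : (k <= K)%N -> p_out J P k <= 1.
Proof.
move=> kK; rewrite (p_outE hP)// -[leRHS](expect_cst (dpmf hP)).
by apply: le_expect => t; case: (_ == _).
Qed.

Lemma p_in_le1 j : (j <= J)%N -> p_in K P j <= 1.
Proof.
move=> jJ; rewrite (p_inE hP)// -[leRHS](expect_cst (dpmf hP)).
by apply: le_expect => t; case: (_ == _).
Qed.

(** Union bound over the degrees. Each elementary event depends on only one of the two samples, so
    the expectation over the other is that of a constant. *)
Lemma prob_bad :
  expect (diid (dpmf hP) (N1 J K delta N)) (fun nt =>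
    expect (diid (dpmf hQ) M) (fun et => (~~ good J K P delta N nt et)%:R)) <=
  bad_const * (((N1 J K delta N)%:R + M%:R + b ^+ 2) / x ^+ 2).
Proof.
set G := fun (n e : nat) (rho : R) =>
  (`|n%:R - rho * (N1 J K delta N)%:R| <= rho * x / 2) &&
  (`|e%:R - rho * (N2 J K delta N)%:R| <= rho * x / 2).
set E := fun F : seq (nat * nat) -> seq (nat * nat) -> R =>
  expect (diid (dpmf hP) (N1 J K delta N)) (fun nt =>
    expect (diid (dpmf hQ) M) (fun et => F nt et)).
have E_sum (I : Type) (s : seq I) F : E (fun nt et => \sum_(i <- s) F i nt et) =
    \sum_(i <- s) E (F i).
  rewrite /E -expect_sum; apply: eq_expect => nt; exact: expect_sum.
have E_G rho (n e : seq (nat * nat) -> nat) :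
    expect (diid (dpmf hP) (N1 J K delta N)) (fun t =>
      (~~ (`|(n t)%:R - rho * (N1 J K delta N)%:R| <= rho * x / 2))%:R) <=
      8 / rho ^+ 2 * ((N1 J K delta N)%:R / x ^+ 2) ->
    expect (diid (dpmf hQ) M) (fun t =>
      (~~ (`|(e t)%:R - rho * (N2 J K delta N)%:R| <= rho * x / 2))%:R) <=
      8 / rho ^+ 2 * ((M%:R + b ^+ 2) / x ^+ 2) ->
    E (fun nt et => (~~ G (n nt) (e et) rho)%:R) <=
      8 / rho ^+ 2 * (((N1 J K delta N)%:R + M%:R + b ^+ 2) / x ^+ 2).
  move=> h1 h2; rewrite -addrA [X in _ * X]mulrDl [leRHS]mulrDr.
  apply: le_trans (lerD h1 h2).
  rewrite -[X in _ <= _ + X](expect_cst (diid (dpmf hP) (N1 J K delta N))) -expectD.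
  apply: le_expect => nt; rewrite -[X in _ <= X + _](expect_cst (diid (dpmf hQ) M)) -expectD.
  by apply: le_expect => et; apply: natr_negb_andb.
apply: (@le_trans _ _ (E (fun nt et =>
    \sum_(k <- iota 1 K) (~~ G (n_out nt k) (e_out R et k) (p_out J P k))%:R +
    \sum_(j <- iota 1 J) (~~ G (n_in nt j) (e_in R et j) (p_in K P j))%:R))).
  apply: le_expect => nt; apply: le_expect => et.
  apply: le_trans (natr_negb_andb _ _ _) _.
  by apply: lerD; apply: natr_negb_all.
have -> : forall F1 F2, E (fun nt et => F1 nt et + F2 nt et) = E F1 + E F2.
  by move=> F1 F2; rewrite /E -expectD; apply: eq_expect => nt; apply: expectD.
rewrite !E_sum mulrDl !mulr_suml.
apply: lerD; rewrite big_seq [leRHS]big_seq; apply: ler_sum => k;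
    rewrite mem_iota add1n ltnS => hk; have [k1 k2] := andP hk; apply: E_G.
- by apply: prob_dev_nodes; [apply: p_outE|apply: p_out_ge0 hP _ _].
- apply: prob_dev_edges => //; [exact: p_out_ge0 hP _ _|exact: p_out_le1|].
  by rewrite -hC1// -q_outE.
- by apply: prob_dev_nodes; [apply: p_inE|apply: p_in_ge0 hP _ _].
- apply: prob_dev_edges => //; [exact: p_in_ge0 hP _ _|exact: p_in_le1|].
  by rewrite -hC2// -q_inE.
Qed.

End BadEvent.

(** * Distance between sampled types and the limit law at fixed [N] *)

Section Closeness.
Variables (R : realType) (s : nat).

Lemma expect_sample_close (T : eqType) (S : seq T) (p : T -> R) (hp : is_pmf S p)
    (t0 : T) (l rest : seq T) (f : s.-tuple T -> R) C :
  uniq S -> all (mem S) l -> (0 < size l)%N -> 0 < C -> (forall t, `|f t| <= C) ->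
  `|expect (diid (dunif R t0 (l ++ rest)) s) f - expect (diid (dpmf hp) s) f| <=
  s%:R * (C * ((2 * (size rest)%:R +
    \sum_(x <- S) `|(count_mem x l)%:R - (size l)%:R * p x|) / (size l)%:R)).
Proof.
move=> uS lS l0 C0 fC; apply: expect_diid_close => // g g1.
exact: expect_dunif_close.
Qed.

(** Types of uniform nodes or edges are uniform draws from the list of types with multiplicity, so
    the graph enters only through that list. *)
Lemma expect_sample_map (T : Type) (U : eqType) (x0 : T) (l : seq T) (h : T -> U) (u0 : U)
    (f : s.-tuple U -> R) : (0 < size l)%N ->
  expect (diid (dunif R x0 l) s) (fun t => f [tuple of [seq h x | x <- t]]) =
  expect (diid (dunif R u0 [seq h x | x <- l]) s) f.
Proof.
move=> l0; apply: expect_diid_map => g.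
by rewrite !expect_dunif ?size_map// big_map.
Qed.

Variables (J K : nat) (P Q : nat * nat -> R).
Hypotheses (hJ : (1 <= J)%N) (hK : (1 <= K)%N).
Hypotheses (hP : is_pmf (node_types J K) P) (hQ : is_pmf (edge_types J K) Q).
Variables (delta : R) (N : nat).
Let n1 := N1 J K delta N.
Let M := nb_edges J K P delta N.
Hypothesis N_large : (2 * slack delta N + maxn (J ^ 2) (K ^ 2) <= N)%N.

Let bad_prob : R := expect (diid (dpmf hP) n1) (fun nt =>
  expect (diid (dpmf hQ) M) (fun et => (~~ good J K P delta N nt et)%:R)).

(** Serves nodes and edges: [V g] is the mean of the test function given the graph, [c] its limit
    value. On [good] the error is [D], a function of the samples alone; otherwise the trivial bound
    [2 * C] is charged to [bad_prob]. *)
Lemma random_digraph_close (V : digraph -> R) (c C : R)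
    (D : n1.-tuple (nat * nat) -> M.-tuple (nat * nat) -> R) :
  (forall g, `|V g| <= C) -> `|c| <= C -> (forall nt et, 0 <= D nt et) ->
  (forall (nt : n1.-tuple (nat * nat)) (et : M.-tuple (nat * nat)) g,
    all (mem (node_types J K)) nt -> all (mem (edge_types J K)) et ->
    [seq node_type g v | v <- iota 1 (nb_nodes g)] = all_node_types J K delta N nt et ->
    [seq edge_type g e | e <- edges g] = all_edge_types R J K et ->
    `|V g - c| <= D nt et) ->
  `|expect (random_digraph hP hQ delta N) V - c| <=
  expect (diid (dpmf hP) n1) (fun nt => expect (diid (dpmf hQ) M) (D nt)) +
  2 * C * bad_prob.
Proof.
move=> VC cC D0 VD; have C0 : 0 <= C := le_trans (normr_ge0 c) cC.
have V2C g : `|V g - c| <= 2 * C.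
  by apply: le_trans (ler_normB _ _) _; rewrite mulr2n mulrDl !mul1r lerD.
rewrite -[X in _ - X](expect_cst (random_digraph hP hQ delta N)) -expectB.
apply: le_trans (ler_norm_expect _ _) _.
rewrite expect_dbind /bad_prob -expectZ -expectD.
have nt_types := @surely_diid R _ _ n1 (mem (node_types J K)) (surely_dpmf hP).
have et_types := @surely_diid R _ _ M (mem (edge_types J K)) (surely_dpmf hQ).
apply: (surely_le nt_types) => nt ntP.
rewrite expect_dbind -expectZ -expectD.
apply: (surely_le et_types) => et etP.
case: ifPn => [nt_good|_].
  rewrite mulr0 addr0 -(expect_cst (allocate R J K (all_node_types J K delta N nt et)
    (all_edge_types R J K et)) (D nt et)).
  have h := allocate_good_types hJ hK hP N_large nt_good ntP etP.
  by apply: (surely_le h) => g [g1 g2]; apply: VD.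
by rewrite expect_dret mulr1 -[leLHS]add0r lerD.
Qed.

Variables (f : s.-tuple (nat * nat) -> R) (C : R).
Hypotheses (C_gt0 : 0 < C) (f_bound : forall t, `|f t| <= C).

Lemma uniq_node_types : uniq (node_types J K).
Proof. by apply: allpairs_uniq; rewrite ?iota_uniq// => -[? ?] [? ?] _ _ /= [-> ->]. Qed.

Lemma uniq_edge_types : uniq (edge_types J K).
Proof. by apply: allpairs_uniq; rewrite ?iota_uniq// => -[? ?] [? ?] _ _ /= [-> ->]. Qed.

Lemma random_node_types_close : (0 < n1)%N ->
  `|expect (random_node_types hP hQ delta s N) f - expect (diid (dpmf hP) s) f| <=
  s%:R * (C * ((2 * (N - n1)%:R + (size (node_types J K))%:R * Num.sqrt n1%:R) / n1%:R))
  + 2 * C * bad_prob.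
Proof.
move=> n1_gt0; rewrite expect_dbind.
have cC (T : Type) (mu : distr R T) (g : T -> R) : (forall t, `|g t| <= C) -> `|expect mu g| <= C.
  exact: expect_norm_le.
(* The sampling error given the types, the [N - n1] added nodes playing the part of [rest]. *)
pose D (nt : n1.-tuple (nat * nat)) : R := s%:R * (C * ((2 * (N - n1)%:R +
  \sum_(x <- node_types J K) `|(count_mem x nt)%:R - n1%:R * P x|) / n1%:R)).
apply: le_trans (@random_digraph_close _ _ C (fun nt _ => D nt) _ _ _ _) _.
- by move=> g; rewrite expect_dbind; apply: (cC) => t; rewrite expect_dret.
- exact: cC.
- move=> nt _; rewrite !mulr_ge0 ?invr_ge0 ?(ltW C_gt0)// addr_ge0//.
  by apply: sumr_ge0.
- move=> nt et g ntP etP gn _.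
  have g0 : (0 < size (iota 1 (nb_nodes g)))%N.
    by rewrite -(size_map (node_type g)) gn size_cat size_tuple ltn_addr.
  rewrite expect_dbind; under eq_expect => t do rewrite expect_dret.
  rewrite (expect_sample_map 0%N (node_type g) (0, 0)%N f g0) gn.
  have := @expect_sample_close _ _ _ hP (0, 0)%N nt _ f C uniq_node_types ntP _ C_gt0 f_bound.
  by rewrite size_tuple => h; apply: le_trans (h _ _) _; rewrite // size_extra_nodes.
rewrite lerD2r; under eq_expect => nt do rewrite expect_cst.
rewrite /D expectZ ler_wpM2l// expectZ ler_wpM2l ?(ltW C_gt0)//.
under eq_expect => nt do rewrite mulrC.
rewrite expectZ mulrC ler_wpM2r ?invr_ge0// expectD expect_cst lerD2l.
exact: expect_sum_count_dev uniq_node_types _.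
Qed.

Lemma random_edge_types_close : (0 < M)%N ->
  `|expect (random_edge_types hP hQ delta s N) f - expect (diid (dpmf hQ) s) f| <=
  s%:R * (C * ((2 * (K ^ 2 + J ^ 2)%:R + (size (edge_types J K))%:R * Num.sqrt M%:R) / M%:R))
  + 2 * C * bad_prob.
Proof.
move=> M_gt0; rewrite expect_dbind.
have cC (T : Type) (mu : distr R T) (g : T -> R) : (forall t, `|g t| <= C) -> `|expect mu g| <= C.
  exact: expect_norm_le.
pose D (et : M.-tuple (nat * nat)) : R := s%:R * (C * ((2 * (K ^ 2 + J ^ 2)%:R +
  \sum_(x <- edge_types J K) `|(count_mem x et)%:R - M%:R * Q x|) / M%:R)).
apply: le_trans (@random_digraph_close _ _ C (fun _ et => D et) _ _ _ _) _.
- by move=> g; rewrite expect_dbind; apply: (cC) => t; rewrite expect_dret.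
- exact: cC.
- move=> _ et; rewrite !mulr_ge0 ?invr_ge0 ?(ltW C_gt0)// addr_ge0//.
  by apply: sumr_ge0.
- move=> nt et g ntP etP _ ge.
  have g0 : (0 < size (edges g))%N.
    by rewrite -(size_map (edge_type g)) ge size_cat size_tuple ltn_addr.
  rewrite expect_dbind; under eq_expect => t do rewrite expect_dret.
  rewrite (expect_sample_map (0, 0)%N (edge_type g) (0, 0)%N f g0) ge.
  have := @expect_sample_close _ _ _ hQ (0, 0)%N et _ f C uniq_edge_types etP _ C_gt0 f_bound.
  rewrite size_tuple => h; apply: le_trans (h _ _) _ => //.
  rewrite ler_wpM2l// ler_wpM2l ?(ltW C_gt0)// ler_wpM2r ?invr_ge0// lerD2r ler_wpM2l//.
  by rewrite ler_nat size_extra_edges.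
rewrite lerD2r expect_cst.
rewrite /D expectZ ler_wpM2l// expectZ ler_wpM2l ?(ltW C_gt0)//.
under eq_expect => et do rewrite mulrC.
rewrite expectZ mulrC ler_wpM2r ?invr_ge0// expectD expect_cst lerD2l.
exact: expect_sum_count_dev uniq_edge_types _.
Qed.

End Closeness.

(** * Rates of convergence *)

Section Rates.
Variables (R : realType) (delta : R).
Hypothesis hdelta : 1 / 2 < delta < 1.

Lemma powR_natr_cvg0 (a : R) : 0 < a -> (N%:R : R) `^ (- a) @[N --> \oo] --> (0 : R).
Proof.
move=> a0; apply/cvgrPdist_le => e e0; near=> N.
have N0 : 0 < N%:R :> R by rewrite ltr0n; near: N; exists 1%N.
rewrite sub0r normrN ger0_norm ?powR_ge0// powRN.
rewrite -[leRHS]invrK lef_pV2 ?posrE ?invr_gt0 ?powR_gt0//.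
have -> : e^-1 = (e^-1 `^ a^-1) `^ a.
  by rewrite -powRrM mulVf ?gt_eqF// powRr1// invr_ge0 ltW.
apply: ge0_ler_powR; rewrite ?nnegrE ?powR_ge0 ?ltW//.
by near: N; apply: nbhs_infty_gtr.
Unshelve. all: by end_near. Qed.

(* The four terms control the share of added nodes, the share of added edges, the
   fluctuations of the empirical type frequencies, and the probability of the
   complement of [good], respectively. *)
Definition rate (N : nat) : R := N%:R `^ (- (1 - delta)) + N%:R `^ (- 1) +
  N%:R `^ (- (1 / 2)) + N%:R `^ (- (2 * delta - 1)).

Lemma rate_cvg0 : rate N @[N --> \oo] --> (0 : R).
Proof.
have -> : (0 : R) = 0 + 0 + 0 + 0 by rewrite !addr0.
move/andP: hdelta => [d1 d2].
apply: cvgD; last by apply: powR_natr_cvg0; lra.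
apply: cvgD; last by apply: powR_natr_cvg0; lra.
by apply: cvgD; apply: powR_natr_cvg0; lra.
Qed.

Lemma cvg_rate (u : nat -> R) l B :
  (\forall N \near \oo, `|u N - l| <= B * rate N) -> u N @[N --> \oo] --> l.
Proof.
move=> hu; apply/cvgrPdist_le => e e0.
have hB : B * rate N @[N --> \oo] --> (0 : R).
  by rewrite -(mulr0 B); apply: cvgMl_tmp rate_cvg0.
near=> N; rewrite distrC.
apply: (@le_trans _ _ (B * rate N)); first by near: N.
apply: le_trans (ler_norm _) _.
by near: N; move/cvgr0Pnorm_le: hB; apply.
Unshelve. all: by end_near. Qed.

Section Bounds.
Variable N : nat.
Hypothesis N_gt0 : (0 < N)%N.
Let NR : 0 < N%:R :> R. Proof. by rewrite ltr0n. Qed.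

Lemma rate_ge0 : 0 <= rate N.
Proof. by rewrite /rate !addr_ge0 ?powR_ge0. Qed.

Lemma powR_le_rate : N%:R `^ delta <= N%:R * rate N.
Proof.
have d0 : 0 < delta by move/andP: hdelta; lra.
have -> : N%:R `^ delta = N%:R * N%:R `^ (- (1 - delta)) :> R.
  by rewrite opprB mulr_powRB1// ltW.
rewrite ler_wpM2l ?(ltW NR)//.
by rewrite /rate -!addrA lerDl !addr_ge0 ?powR_ge0.
Qed.

Lemma one_le_rate : 1 <= N%:R * rate N.
Proof.
rewrite -ler_pdivrMl// mulr1 -powR_inv1 ?(ltW NR)//.
by rewrite /rate -!addrA addrCA lerDl !addr_ge0 ?powR_ge0.
Qed.

Lemma sqrt_le_rate : (Num.sqrt N%:R)^-1 <= rate N.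
Proof.
rewrite -powR12_sqrt ?(ltW NR)// -powRN -div1r.
by rewrite /rate addrAC addrC lerDl !addr_ge0 ?powR_ge0.
Qed.

Lemma chebyshev_le_rate : N%:R / (N%:R `^ delta) ^+ 2 <= rate N.
Proof.
have -> : N%:R / (N%:R `^ delta) ^+ 2 = N%:R `^ (- (2 * delta - 1)) :> R.
  have N0 : N%:R != 0 :> R by rewrite gt_eqF.
  rewrite opprB powRB ?N0 ?implybT// powRr1 ?(ltW NR)//.
  by rewrite expr2 -powRD ?N0 ?implybT//; congr (_ / _ `^ _); ring.
by rewrite /rate lerDr !addr_ge0 ?powR_ge0.
Qed.

(** Here [n] is the sample size, at least [w * N], [r] the number of added entries and [A] the
    number of possible types. *)
Lemma sampling_le_rate (n r : nat) (w c A : R) : 0 < w -> 0 <= c -> 0 <= A ->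
  w * N%:R <= n%:R -> r%:R <= c * (N%:R * rate N) ->
  (2 * r%:R + A * Num.sqrt n%:R) / n%:R <= (2 * c / w + A / Num.sqrt w) * rate N.
Proof.
move=> w0 c0 A0 wn rc.
have wN : 0 < w * N%:R by rewrite mulr_gt0.
have n0 : 0 < n%:R :> R by apply: lt_le_trans wn.
have sw : 0 < Num.sqrt w by rewrite sqrtr_gt0.
rewrite mulrDl [leRHS]mulrDl; apply: lerD.
  rewrite ler_pdivrMr//; apply: (@le_trans _ _ (2 * (c * (N%:R * rate N)))).
    by rewrite ler_pM2l.
  apply: (@le_trans _ _ (2 * c / w * rate N * (w * N%:R))); last first.
    by rewrite ler_wpM2l// mulr_ge0 ?rate_ge0// divr_ge0 ?(ltW w0)// mulr_ge0.
  by rewrite le_eqVlt; apply/orP; left; apply/eqP; field; rewrite gt_eqF//.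
have sn : 0 < Num.sqrt n%:R :> R by rewrite sqrtr_gt0.
rewrite -!mulrA ler_wpM2l//.
have -> : Num.sqrt n%:R / n%:R = (Num.sqrt n%:R)^-1 :> R.
  by rewrite -{2}[n%:R]sqr_sqrtr ?ltW// expr2 invfM mulVKf ?gt_eqF.
apply: (@le_trans _ _ ((Num.sqrt w)^-1 * (Num.sqrt N%:R)^-1)); last first.
  by rewrite ler_wpM2l ?invr_ge0 ?(ltW sw)// sqrt_le_rate.
rewrite -invfM -sqrtrM ?(ltW w0)// lef_pV2 ?posrE ?sqrtr_gt0//.
exact: ler_wsqrtr.
Qed.

End Bounds.

Variables (J K : nat).

Lemma extra_nodes_le_rate N : (0 < N)%N ->
  (2 * slack delta N + maxn (J ^ 2) (K ^ 2))%:R <=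
  (4 + (maxn (J ^ 2) (K ^ 2))%:R) * (N%:R * rate N).
Proof.
move=> N0; set mx := maxn _ _.
have h1 : (slack delta N)%:R <= N%:R `^ delta + 1 :> R.
  by rewrite ltW// natceil_lt// powR_ge0.
have h2 := powR_le_rate N0; have h3 := one_le_rate N0.
have m0 : 0 <= mx%:R :> R by rewrite ler0n.
(* Both [N^delta] and 1 are at most [N * rate N], so twice the slack costs 4 of these units and the
   constant [mx] costs [mx] of them. *)
rewrite natrD natrM; nra.
Qed.

(** Since [rate] tends to 0, the reserve is eventually at most half of the nodes. This keeps the
    subtraction in [N1] from truncating and makes [N1] and [nb_edges] at least linear in [N]. *)
Lemma near_extra_nodes : \forall N \near \oo,
  (0 < N)%N /\ (2 * slack delta N + maxn (J ^ 2) (K ^ 2))%:R <= N%:R / 2 :> R.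
Proof.
set c : R := (4 + (maxn (J ^ 2) (K ^ 2))%:R) * 2.
have c0 : 0 < c by rewrite mulr_gt0// ltr_wpDr.
near=> N; have N0 : (0 < N)%N by near: N; exists 1%N.
split=> //; apply: le_trans (extra_nodes_le_rate N0) _.
have hr : rate N <= c^-1.
  apply: le_trans (ler_norm _) _; near: N.
  by move/cvgr0Pnorm_le: rate_cvg0; apply; rewrite invr_gt0.
rewrite mulrCA ler_wpM2l// -[X in X * _](mulfK (_ : 2 != 0 :> R))// -/c mulrAC.
by rewrite ler_piMl ?invr_ge0// -ler_pdivlMl// mulr1.
Unshelve. all: by end_near. Qed.

End Rates.

(** * Assembling the bounds for large [N] *)

Section Convergence.
Variables (R : realType) (J K : nat).
Variables (P Q : nat * nat -> R).
Hypotheses (hP : is_pmf (node_types J K) P) (hQ : is_pmf (edge_types J K) Q).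
Hypothesis hz : 0 < mean_degree J K P.
Hypotheses (hC1 : consistency1 J K P Q) (hC2 : consistency2 J K P Q).
Variable delta : R.
Let z := mean_degree J K P.

Section LargeN.
Variable N : nat.
Hypothesis N_gt0 : (0 < N)%N.
Hypothesis extra_small :
  (2 * slack delta N + maxn (J ^ 2) (K ^ 2))%:R <= N%:R / 2 :> R.

Lemma extra_le : (2 * slack delta N + maxn (J ^ 2) (K ^ 2) <= N)%N.
Proof.
rewrite -(ler_nat R); apply: le_trans extra_small _.
by rewrite ler_pdivrMr// ler_peMr// ler1n.
Qed.

Lemma half_le_N1 : 2^-1 * N%:R <= (N1 J K delta N)%:R :> R.
Proof. by rewrite /N1 natrB ?extra_le//; move: extra_small; lra. Qed.

Lemma N1_gt0 : (0 < N1 J K delta N)%N.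
Proof.
rewrite -(ltr_nat R); apply: lt_le_trans half_le_N1.
by rewrite mulr_gt0 ?invr_gt0 ?ltr0n.
Qed.

Lemma N2_le : (N2 J K delta N <= N)%N.
Proof. by rewrite /N2 /N1; have := extra_le; lia. Qed.

Lemma nb_edges_ge : z / 2 * N%:R <= (nb_edges J K P delta N)%:R.
Proof.
apply: (@le_trans _ _ (z * (N2 J K delta N)%:R)); last first.
  by apply: natceil_ge; rewrite mulr_ge0// ltW.
rewrite -mulrA ler_pM2l//; apply: le_trans half_le_N1 _.
by rewrite ler_nat leq_addr.
Qed.

Lemma nb_edges_gt0 : (0 < nb_edges J K P delta N)%N.
Proof.
rewrite -(ltr_nat R); apply: lt_le_trans nb_edges_ge.
by rewrite mulr_gt0 ?ltr0n// divr_gt0.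
Qed.

Lemma prob_bad_le_rate :
  expect (diid (dpmf hP) (N1 J K delta N)) (fun nt =>
    expect (diid (dpmf hQ) (nb_edges J K P delta N)) (fun et =>
      (~~ good J K P delta N nt et)%:R)) <=
  bad_const J K P * (2 + z + (1 + z^-1) ^+ 2) * rate delta N.
Proof.
apply: le_trans (prob_bad hP hQ hz hC1 hC2 _ N_gt0) _.
rewrite -mulrA ler_wpM2l ?bad_const_ge0//.
have x0 : 0 < N%:R `^ delta :> R by apply: powR_gt0; rewrite ltr0n.
have hM : (nb_edges J K P delta N)%:R <= z * N%:R + 1.
  apply: le_trans (ltW (natceil_lt _)) _; first by rewrite mulr_ge0// ltW.
  by rewrite lerD2r ler_pM2l// ler_nat N2_le.
have hN1 : (N1 J K delta N)%:R <= N%:R :> R by rewrite ler_nat leq_subr.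
have N1R : 1 <= N%:R :> R by rewrite ler1n.
set w : R := 1 + z^-1; have w0 : 0 <= w ^+ 2 by apply: sqr_ge0.
(* The numerator is at most [N + (z N + 1) + w^2], and [1 <= N] lets each constant absorb a factor
   [N]. *)
apply: (@le_trans _ _ ((2 + z + w ^+ 2) * (N%:R / (N%:R `^ delta) ^+ 2))).
  rewrite mulrA ler_wpM2r ?invr_ge0 ?sqr_ge0//; nra.
rewrite ler_wpM2l ?chebyshev_le_rate//.
by rewrite !addr_ge0// ltW.
Qed.

End LargeN.

Lemma close_le_rate (s : nat) (C S B r d : R) :
  0 < C -> S <= B * r -> d <= bad_const J K P * (2 + z + (1 + z^-1) ^+ 2) * r ->
  s%:R * (C * S) + 2 * C * d <=
  (s%:R * (C * B) + 2 * C * (bad_const J K P * (2 + z + (1 + z^-1) ^+ 2))) * r.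
Proof.
move=> C0 hS hd; rewrite [leRHS]mulrDl; apply: lerD.
  by rewrite -!mulrA ler_wpM2l// ler_pM2l.
rewrite -[leRHS]mulrA ler_wpM2l//.
by rewrite mulr_ge0// ltW.
Qed.

End Convergence.

Theorem theorem2p3 (R : realType) (J K : nat) (hJ : (1 <= J)%N) (hK : (1 <= K)%N)
    (P Q : nat * nat -> R)
    (hP : is_pmf (node_types J K) P) (hQ : is_pmf (edge_types J K) Q)
    (hz : 0 < mean_degree J K P)
    (hC1 : consistency1 J K P Q) (hC2 : consistency2 J K P Q)
    (delta : R) (hdelta : 1 / 2 < delta < 1) (s : nat) :
  cvg_in_distr (admissible J K delta)
    (random_node_types hP hQ delta s) (diid (dpmf hP) s) /\
  cvg_in_distr (admissible J K delta)
    (random_edge_types hP hQ delta s) (diid (dpmf hQ) s).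
Proof.
have bound (f : s.-tuple (nat * nat) -> R) :
    (exists C, forall x, `|f x| <= C) -> exists2 C, 0 < C & forall x, `|f x| <= C.
  case=> C hC; exists (Num.max C 1) => [|x]; first by rewrite lt_max ltr01 orbT.
  by rewrite le_max hC.
pose B C b : R := s%:R * (C * b) +
  2 * C * (bad_const J K P * (2 + mean_degree J K P + (1 + (mean_degree J K P)^-1) ^+ 2)).
(* The limit is established along all [N], which implies it along the admissible ones. *)
split=> f /bound[C C0 fC]; apply: cvg_trans (cvg_app _ (@cvg_within _ _ _ _)) _.
(* Constant of [sampling_le_rate] with [w = 1 / 2] from [half_le_N1] and [c] from
   [extra_nodes_le_rate]. *)
- pose b : R := 2 * (4 + (maxn (J ^ 2) (K ^ 2))%:R) / 2^-1 +
    (size (node_types J K))%:R / Num.sqrt 2^-1.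
  apply: (cvg_rate hdelta (B := B C b)); near=> N.
  have [N0 hN] : (0 < N)%N /\
      (2 * slack delta N + maxn (J ^ 2) (K ^ 2))%:R <= N%:R / 2 :> R.
    by near: N; apply: near_extra_nodes.
  apply: le_trans (random_node_types_close hJ hK hP hQ (extra_le hN) C0 fC (N1_gt0 N0 hN)) _.
  apply: close_le_rate C0 _ (prob_bad_le_rate hP hQ hz hC1 hC2 N0 hN).
  rewrite /b; apply: sampling_le_rate => //; first exact: half_le_N1.
  by rewrite subKn ?(extra_le hN)//; apply: extra_nodes_le_rate.
(* Here [w = z / 2], and the number of added edges is bounded by a constant, absorbed through
   [1 <= N * rate N]. *)
- pose b : R := 2 * (K ^ 2 + J ^ 2)%:R / (mean_degree J K P / 2) +
    (size (edge_types J K))%:R / Num.sqrt (mean_degree J K P / 2).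
  apply: (cvg_rate hdelta (B := B C b)); near=> N.
  have [N0 hN] : (0 < N)%N /\
      (2 * slack delta N + maxn (J ^ 2) (K ^ 2))%:R <= N%:R / 2 :> R.
    by near: N; apply: near_extra_nodes.
  apply: le_trans (random_edge_types_close hJ hK hP hQ (extra_le hN) C0 fC
    (nb_edges_gt0 hz N0 hN)) _.
  apply: close_le_rate C0 _ (prob_bad_le_rate hP hQ hz hC1 hC2 N0 hN).
  rewrite /b; apply: sampling_le_rate => //; [by rewrite divr_gt0|exact: nb_edges_ge|].
  by rewrite -[leLHS]mulr1 ler_wpM2l// one_le_rate.
Unshelve. all: by end_near. Qed.
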